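(* Let $\alpha_1,\alpha_2\in(0,1)$, $\lambda_1,\lambda_2>0$, $c_1,c_2\ge 0$ with $c_1+c_2=1$. The probability density function $G(x,t)$ (in $x>0$) of the mixture tempered stable subordinator $S_{\alpha_1,\lambda_1,\alpha_2,\lambda_2}(t)$ satisfies the fractional partial differential equation $$\frac{\partial}{\partial t}G(x,t)=-c_1\Big(\lambda_1+\frac{\partial}{\partial x}\Big)^{\alpha_1}G(x,t)-c_2\Big(\lambda_2+\frac{\partial}{\partial x}\Big)^{\alpha_2}G(x,t)+c_1\lambda_1^{\alpha_1}G(x,t)+c_2\lambda_2^{\alpha_2}G(x,t),$$ with the conditions $G(x,0)=\delta(x)$ and $G(0,t)=0$.
   Context: The mixture tempered stable subordinator (MTSS) $S_{\alpha_1,\lambda_1,\alpha_2,\lambda_2}(t)$, $t\ge0$, is the nondecreasing Lévy process with Laplace transform $$\mathbb{E}\big(e^{-sS_{\alpha_1,\lambda_1,\alpha_2,\lambda_2}(t)}\big)=\exp\Big(-t\big(c_1((s+\lambda_1)^{\alpha_1}-\lambda_1^{\alpha_1})+c_2((s+\lambda_2)^{\alpha_2}-\lambda_2^{\alpha_2})\big)\Big),\quad s>0 .$$ For $c\ge0$ and $\nu\in(0,1)$ the shifted fractional Riemann–Liouville derivative $(c+\frac{\partial}{\partial y})^{\nu}$ in a variable $y\ge0$ is characterized through the Laplace transform $\mathcal{L}_y$ in $y$ by $$\mathcal{L}_y\Big[\Big(c+\frac{\partial}{\partial y}\Big)^{\nu}f\Big](s)=(c+s)^{\nu}\,\mathcal{L}_y[f](s)-(c+s)^{\nu-1}f(0),\quad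 s>0 ;$$ here it is applied in the variable $y=x$. $\delta$ is the Dirac delta (i.e. $S_{\alpha_1,\lambda_1,\alpha_2,\lambda_2}(0)=0$), and $G(0,t)=0$, for $t>0$, is the boundary value as $x\downarrow0$. *)

(* Defs.v *)
From mathcomp Require Export all_boot all_order all_algebra.
From mathcomp Require Export all_classical all_reals all_analysis.

Set Implicit Arguments.
Unset Strict Implicit.
Unset Printing Implicit Defensive.

Import Order.TTheory GRing.Theory Num.Theory.
Import numFieldNormedType.Exports.

Local Open Scope classical_set_scope.
Local Open Scope ring_scope.

(* Processes and densities are indexed by all of R; only times t >= 0 (resp.
   t > 0) are ever constrained. *)

Section levy.
Context (R : realType) (d : measure_display) (T : measurableType d)
  (P : probability T R).
Implicit Type S : R -> {RV P >-> R}.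

Definition increment S (s t : R) : T -> R := fun w => S t w - S s w.

(* Mutual independence of the increments over consecutive intervals: taking
   some of the sets B i to be setT gives the product rule on subfamilies. *)
Definition independent_increments S : Prop :=
  forall (n : nat) (t : nat -> R) (B : nat -> set R),
    0 <= t 0%N ->
    (forall i, (i < n)%N -> t i <= t i.+1) ->
    (forall i, (i < n)%N -> measurable (B i)) ->
    P (\bigcap_(i < n) (increment S (t i) (t i.+1) @^-1` B i)) =
    (\prod_(i < n) P (increment S (t i) (t i.+1) @^-1` B i))%E.

Definition stationary_increments S : Prop :=
  forall (t h : R) (B : set R), 0 <= t -> 0 <= h -> measurable B ->
    P (increment S t (t + h) @^-1` B) = P (S h @^-1` B).

Definition stochastically_continuous S : Prop :=
  forall (t e : R), 0 <= t -> 0 < e ->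
    P [set w | e <= `|increment S t u w|] @[u --> within (>= 0) (nbhs t)]
      --> 0%E.

Definition levy_process S : Prop :=
  [/\ {ae P, forall w, S 0 w = 0},
      independent_increments S,
      stationary_increments S &
      stochastically_continuous S].

Definition nondecreasing_process S : Prop :=
  {ae P, forall w, forall s t : R, 0 <= s -> s <= t -> S s w <= S t w}.

Definition mtss (a1 l1 a2 l2 c1 c2 : R) S : Prop :=
  [/\ levy_process S,
      nondecreasing_process S &
      forall t s : R, 0 <= t -> 0 < s ->
        ('E_P[fun w => expR (- (s * S t w))])%E =
        (expR (- (t * (c1 * ((s + l1) `^ a1 - l1 `^ a1) +
                       c2 * ((s + l2) `^ a2 - l2 `^ a2)))))%:E].

(* A density is only determined up to null sets; continuity in x selects the
   unique version for which a pointwise equation is meaningful. *)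
Definition density_of S (G : R -> R -> R) : Prop :=
  forall t : R, 0 < t ->
    [/\ {in `]0, +oo[, continuous (G ^~ t)},
        forall x : R, 0 < x -> 0 <= G x t &
        forall A : set R, measurable A ->
          distribution P (S t) A =
          (\int[lebesgue_measure]_(x in A `&` `]0%R, +oo[) (G x t)%:E)%E].

End levy.

Section fractional.
Context (R : realType).
Implicit Types (f g : R -> R).

Definition laplace_integrable f (s : R) : Prop :=
  lebesgue_measure.-integrable `[0, +oo[ (fun y => (expR (- (s * y)) * f y)%:E).

Definition laplace f (s : R) : R :=
  \int[lebesgue_measure]_(y in `[0, +oo[) (expR (- (s * y)) * f y).

(* [shifted_RL c nu f g] : g is (c + d/dy)^nu f.  The boundary value f(0) is
   the limit of f at 0+.  The Laplace transform only determines g up to null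
   sets; continuity on ]0, +oo[ makes it unique there. *)
Definition shifted_RL (c nu : R) f g : Prop :=
  {in `]0, +oo[, continuous g} /\
  exists2 f0 : R, f y @[y --> 0^'+] --> f0 &
    forall s : R, 0 < s ->
      [/\ laplace_integrable f s,
          laplace_integrable g s &
          laplace g s = (c + s) `^ nu * laplace f s - (c + s) `^ (nu - 1) * f0].

(* The measures G(x, t) dx on ]0, +oo[ converge weakly to the Dirac measure
   at 0 as t decreases to 0. *)
Definition initially_dirac (G : R -> R -> R) : Prop :=
  forall phi : R -> R, continuous phi -> (exists M : R, forall x : R, `|phi x| <= M) ->
    (\int[lebesgue_measure]_(x in `]0, +oo[) (phi x * G x t)) @[t --> 0^'+]
      --> phi 0.

End fractional.

(* Main.v *)
(** Let [psi] be the Laplace exponent, so that [S t] has Laplace transform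
    [exp (- t psi)].  No Fourier inversion is needed.  Differentiating in [s]
    corresponds to multiplication by [x], and each derivative of
    [(s + l1)^-b (s + l2)^-g exp (- t psi s)] is a combination of functions of the
    same form with larger [b + g].  Once [b + g] is large, such a function is the
    transform of a convolution of Gamma kernels with the law of [S t]: a bounded
    function, continuous in [x] and [t], and vanishing to infinite order at 0 by
    Chernoff's bound.  The latter allows one to divide by powers of [x], and hence to
    represent [(s + l1)^-b (s + l2)^-g exp (- t psi s)] for all [b, g >= -1].  The
    exponents [(0, 0)], [(- a1, 0)], [(0, - a2)] give the density [G] and its two
    shifted fractional derivatives.  By uniqueness of Laplace transforms [G] is the
    density of [S t], and [G x t - G x t'] is the integral over [[t', t]] of the right
    side of the equation, which is continuous in time. *)

Require Import Defs.
Import Order.TTheory GRing.Theory Num.Theory.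
Import numFieldNormedType.Exports.
From HB Require Import structures.
From mathcomp Require Import measurable_realfun ring lra.
Local Open Scope classical_set_scope.
Local Open Scope ring_scope.

Set Implicit Arguments.
Unset Strict Implicit.
Unset Printing Implicit Defensive.

(** * Lebesgue measure under affine maps, Laplace integrals on the line *)

(** The obstacle is the growing factor in [(s + l1)^a1 exp (- t psi s)]: it does not come from
    convolving an integrable kernel with the law of [S t]. Differentiation helps because [psi'] is a
    combination of [(s + l1)^(a1 - 1)] and [(s + l2)^(a2 - 1)]; even the factor produced by
    [exp (- t psi)] thus raises [b + g] by [1 - a1] or [1 - a2], which is positive. Conversely
    [a1, a2 > 0], with one of [c1, c2] positive, makes [exp (- t psi s)] decay faster than every
    power of [s]. This gives the flatness at 0 and the vanishing at infinity that fixes the constant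
    of integration in [s]. Flatness also makes the boundary value 0, so that a shifted derivative is
    plain multiplication of the transform by [(c + s)^nu]. Gamma kernels are bounded only for shapes
    at least 1, which is why exponents have to be traded between the two factors. In time, flat
    densities record only continuity; hence the equation is derived from its integrated form. *)

Section affine_change.
Context {R : realType}.
Notation mu := (@lebesgue_measure R).
Implicit Types (a c : R).

Lemma measurable_affine c a :
  measurable_fun [set: R] (fun x : R => c * x + a : measurableTypeR R).
Proof.
by apply: measurable_funD => //; apply: measurable_funM.
Qed.

(** The scaled image measure agrees with Lebesgue measure on half-open intervals, and these
    determine it. *)
Lemma lebesgue_measure_affine c a (A : set R) : 0 < c -> measurable A ->
  (c%:E * mu ((fun x : R => c * x + a)%R @^-1` A) = mu A)%E.
Proof.
move=> c0 mA.
pose phi (x : R) : measurableTypeR R := c * x + a.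
have mphi : measurable_fun [set: measurableTypeR R] phi by exact: measurable_affine.
pose m :
  {measure set (measurableTypeR R) -> \bar R} :=
  mscale (NngNum (ltW c0)) (pushforward mu phi).
suff: forall X, ocitv X -> mu X = m mphi X.
  by move=> /lebesgue_measure_unique /(_ _ mA) ->.
move=> _ [[x y]] _ <-.
rewrite /m /= /mscale /= /pushforward.
rewrite (_ : phi @^-1` _ = `](x - a) / c, (y - a) / c]%classic); last first.
  apply/seteqP; split => z /=; rewrite !in_itv/= /phi ltr_pdivrMr// ler_pdivlMr//.
    by rewrite ltrBlDr lerBrDr mulrC.
  by rewrite ltrBlDr lerBrDr mulrC.
rewrite !lebesgue_measure_itv/= !lte_fin ltr_pM2r ?invr_gt0// ltrD2r.
case: ifPn => xy; last by rewrite mule0.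
rewrite !EFinN -!EFinD -EFinM; congr EFin; field.
by rewrite gt_eqF.
Qed.

Lemma ge0_integral_affine c a (f : R -> \bar R) : 0 < c ->
  measurable_fun [set: R] f -> (forall x, 0 <= f x)%E ->
  (\int[mu]_x f x = c%:E * \int[mu]_x f (c * x + a)%R)%E.
Proof.
move=> c0 mf f0.
pose phi (x : R) : measurableTypeR R := c * x + a.
have mphi : measurable_fun [set: measurableTypeR R] phi by exact: measurable_affine.
rewrite (_ : (\int[mu]_x f (c * x + a)%R = \int[pushforward mu phi]_x f x)%E); last first.
  by rewrite (ge0_integral_pushforward mphi)//.
rewrite -(ge0_integral_mscale _ _ (NngNum (ltW c0)))//.
apply: eq_measure_integral => A mA _.
exact: (esym (lebesgue_measure_affine a c0 mA)).
Qed.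

(** No integrability is assumed: the positive and negative parts are shifted separately. *)
Lemma integral_shift a (f : R -> \bar R) :
  measurable_fun [set: R] f ->
  (\int[mu]_x f x = \int[mu]_x f (x + a)%R)%E.
Proof.
move=> mf; rewrite integralE [RHS]integralE.
have h (g : R -> \bar R) : measurable_fun [set: R] g -> (forall x, 0 <= g x)%E ->
    (\int[mu]_x g x = \int[mu]_x g (x + a)%R)%E.
  move=> mg g0; rewrite (ge0_integral_affine a ltr01)// mul1e.
  by under eq_integral do rewrite mul1r.
congr (_ - _)%E.
  rewrite (h _ (measurable_funepos mf) (fun=> funepos_ge0 _ _)).
  by apply: eq_integral => x _; rewrite (funepos_comp f (fun y => y + a)).
rewrite (h _ (measurable_funeneg mf) (fun=> funeneg_ge0 _ _)).
by apply: eq_integral => x _; rewrite (funeneg_comp f (fun y => y + a)).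
Qed.

End affine_change.

Section laplace_line.
Context {R : realType}.
Notation mu := (@lebesgue_measure R).
Implicit Types (v : R -> R) (s C : R).

(** The integral runs over the whole line so that translations do not change the domain; it is
    applied to functions that vanish on the negative half-line. *)
Definition lap v s : R := \int[mu]_x (expR (- (s * x)) * v x).

Lemma measurable_expN s : measurable_fun [set: R] (fun x : R => expR (- (s * x))).
Proof.
apply: measurableT_comp => //; apply: measurable_funN.
exact: measurable_funM.
Qed.

(** The exponential density serves as dominating function: it is integrable, and its total mass 1
    turns this estimate into the bound [C / s] on the transform. *)
Lemma laplace_dominated C v s x : 0 < s -> (forall x, x < 0 -> v x = 0) ->
  (forall x, `|v x| <= C) ->
  `|expR (- (s * x)) * v x| <= C / s * exponential_pdf s x.
Proof.
move=> s0 v0 vC.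
have [x0|x0] := ltP x 0; first by rewrite v0// mulr0 normr0 lt0_exponential_pdf// mulr0.
have -> : exponential_pdf s x = s * expR (- s * x) by exact: exponential_pdfE.
rewrite normrM ger0_norm ?expR_ge0//.
by rewrite mulrA divfK ?gt_eqF// mulNr mulrC ler_wpM2r ?expR_ge0.
Qed.

Lemma laplace_line_integrable C v s : 0 < s -> measurable_fun [set: R] v ->
  (forall x, x < 0 -> v x = 0) -> (forall x, `|v x| <= C) ->
  mu.-integrable [set: R] (fun x => (expR (- (s * x)) * v x)%:E).
Proof.
move=> s0 mv v0 vC.
apply: (@le_integrable _ _ _ mu _ measurableT _ (fun x => (C / s)%:E * (exponential_pdf s x)%:E)%E).
- by apply/measurable_EFinP; apply: measurable_funM => //; exact: measurable_expN.
- move=> x _; rewrite -EFinM lee_fin [leRHS]ger0_norm.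
    exact: laplace_dominated.
  apply: le_trans (normr_ge0 _) (laplace_dominated x s0 v0 vC).
- apply: integrableZl => //; exact: integrable_exponential_pdf.
Qed.

Lemma lap_bound C v s : 0 < s -> measurable_fun [set: R] v ->
  (forall x, x < 0 -> v x = 0) -> (forall x, `|v x| <= C) ->
  `|lap v s| <= C / s.
Proof.
move=> s0 mv v0 vC.
have iv := laplace_line_integrable s0 mv v0 vC.
have ie := integrable_exponential_pdf s0.
have -> : C / s = \int[mu]_x (C / s * exponential_pdf s x).
  rewrite RintegralZl//; rewrite /Rintegral integral_exponential_pdf//=.
  by rewrite mulr1.
apply: le_trans (le_normr_Rintegral measurableT iv) _.
apply: le_Rintegral => //.
- exact: integrable_norm.
- rewrite /comp; under eq_fun do rewrite EFinM.
  exact: integrableZl.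
- by move=> x _; exact: laplace_dominated.
Qed.

End laplace_line.

(** * Mixtures of translates *)

Section bounded_multiplier.
Context {R : realType} d {Y : measurableType d} (m : {measure set Y -> \bar R}).

Lemma integrable_bounded_mul (h g : Y -> R) (C : R) :
  m.-integrable [set: Y] (EFin \o h) -> measurable_fun [set: Y] g ->
  (forall y, `|g y| <= C) -> m.-integrable [set: Y] (fun y => (h y * g y)%:E).
Proof.
move=> ih mg gC.
apply: (@le_integrable _ _ _ m _ measurableT _ (fun y => C%:E * (h y)%:E)%E).
- apply/measurable_EFinP; apply: measurable_funM => //.
  by apply/measurable_EFinP; case/integrableP : ih.
- move=> y _; rewrite -EFinM lee_fin !normrM mulrC ler_wpM2r//.
  exact: le_trans (gC y) (ler_norm C).
- exact: integrableZl.
Qed.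

Lemma measurable_norm_ge (f : Y -> R) (e : R) : measurable_fun [set: Y] f ->
  measurable [set y | e <= `|f y|].
Proof.
move=> mf; rewrite (_ : [set y | _] = (fun y => `|f y|) @^-1` `[e, +oo[); last first.
  by apply/seteqP; split => y /=; rewrite in_itv/= andbT.
have mN : measurable_fun [set: Y] (fun y => `|f y|) by exact: measurableT_comp.
by rewrite -[X in measurable X]setTI; exact: mN.
Qed.

Lemma measurable_gt_indicator (f : Y -> R) (a : R) : measurable_fun [set: Y] f ->
  measurable_fun [set: Y] (fun y => ((a < f y)%R)%:R : R).
Proof.
move=> mf; rewrite (_ : (fun y => _) = (fun y => if a < f y then 1 else 0)); last first.
  by apply/funext => y; case: ifP.
by apply: measurable_fun_ifT => //; exact: measurable_fun_ltr.
Qed.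

End bounded_multiplier.

Section superposition.
Context {R : realType} d {Y : measurableType d}
  (m : {sigma_finite_measure set Y -> \bar R}).
Notation mu := (@lebesgue_measure R).
Variables (g X : Y -> R).
Hypothesis mg : measurable_fun [set: Y] g.
Hypothesis mX : measurable_fun [set: Y] X.
Hypothesis g0 : forall y, 0 <= g y.
Hypothesis X0 : forall y, 0 <= X y.
Hypothesis ig : m.-integrable [set: Y] (EFin \o g).
Implicit Types (v : R -> R) (s C : R).

(** Covers two convolutions at once: with the law of a random variable ([m] a probability, [g = 1])
    and with a Gamma kernel ([m] Lebesgue measure, [X] the positive part). *)
Definition superpose v (x : R) : R := \int[m]_y (g y * v (x - X y)).

Lemma weighted_bound (h : Y -> R) C : measurable_fun [set: Y] h ->
  (forall y, `|h y| <= C) ->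
  `|\int[m]_y (g y * h y)| <= C * \int[m]_y g y.
Proof.
move=> mh hC.
have ih := integrable_bounded_mul ig mh hC.
rewrite -RintegralZl//; apply: le_trans (le_normr_Rintegral measurableT ih) _.
apply: le_Rintegral => //.
- exact: integrable_norm.
- rewrite /comp; under eq_fun do rewrite EFinM.
  exact: integrableZl.
- by move=> y _; rewrite normrM (ger0_norm (g0 y)) mulrC ler_wpM2r.
Qed.

(** The parameter [l] stands for the point [x] as well as for the time [t]; the function [C * g]
    dominates. *)
Lemma weighted_continuous (w : R -> Y -> R) C (a b : R) :
  (forall l, l \in `]a, b[ -> measurable_fun [set: Y] (w l)) ->
  (forall l y, l \in `]a, b[ -> `|w l y| <= C) ->
  (forall y, {in `]a, b[, continuous (w ^~ y)}) ->
  {in `]a, b[, continuous (fun l => \int[m]_y (g y * w l y))}.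
Proof.
move=> mw wC cw l lab.
have := @continuity_under_integral R d Y m (fun l y => g y * w l y) setT measurableT a b _ _
 (fun y => C * g y) _ _ l.
apply.
- by move=> x xab; apply: (integrable_bounded_mul ig (C := C)); [exact: mw|move=> y; exact: wC].
- apply: aeW => y _ x /set_mem xab.
  by apply: cvgM; [exact: cvg_cst|exact: cw].
- rewrite /comp; under eq_fun do rewrite EFinM.
  exact: integrableZl.
- move=> x xab; apply: aeW => y _.
  by rewrite normrM (ger0_norm (g0 y)) mulrC ler_wpM2r//; exact: wC.
- exact: mem_set.
Qed.

Lemma measurable_shiftX v x : measurable_fun [set: R] v ->
  measurable_fun [set: Y] (fun y => v (x - X y)).
Proof.
move=> mv; apply: (measurableT_comp mv).
exact: measurable_funB.
Qed.

Lemma superpose_continuous v C : continuous v -> (forall x, `|v x| <= C) ->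
  continuous (superpose v).
Proof.
move=> cv vC x.
apply: (@weighted_continuous (fun l y => v (l - X y)) C (x - 1) (x + 1)).
- move=> l _; apply: measurable_shiftX; exact: continuous_measurable_fun.
- by move=> *; exact: vC.
- move=> y l _; apply: continuous_comp; last exact: cv.
  by apply: cvgB; [exact: cvg_id|exact: cvg_cst].
- by rewrite in_itv/=; lra.
Qed.

Lemma superpose_le0 v x : (forall x, x <= 0 -> v x = 0) -> x <= 0 ->
  superpose v x = 0.
Proof.
move=> v0 x0; rewrite /superpose.
rewrite (@eq_Rintegral _ _ _ _ _ (fun=> 0)) => [|y _]; first by rewrite Rintegral_cst// mul0r.
by rewrite v0 ?mulr0// subr_le0 (le_trans x0).
Qed.

(** For fixed [y], translation by [X y] splits [exp (- s X y)] off the integral over [x]; Fubini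
    does the rest. *)
Lemma lap_superpose v C s : 0 < s -> continuous v ->
  (forall x, x <= 0 -> v x = 0) -> (forall x, `|v x| <= C) ->
  lap (superpose v) s = \int[m]_y (g y * expR (- (s * X y))) * lap v s.
Proof.
move=> s0 cv v0 vC.
have mv := continuous_measurable_fun cv.
have v0' x : x < 0 -> v x = 0 by move=> /ltW; exact: v0.
have iv := laplace_line_integrable s0 mv v0' vC.
pose F (z : R * Y) : R := expR (- (s * z.1)) * (g z.2 * v (z.1 - X z.2)).
have mF : measurable_fun [set: measurableTypeR R * Y] (EFin \o F).
  apply/measurable_EFinP; apply: measurable_funM.
    by apply: (measurableT_comp (measurable_expN s)).
  apply: measurable_funM; first exact: (measurableT_comp mg).
  apply: (measurableT_comp mv); apply: measurable_funB => //.
  exact: (measurableT_comp mX).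
have Fshift x y : F (x + X y, y) = g y * expR (- (s * X y)) * (expR (- (s * x)) * v x).
  by rewrite /F /= addrK mulrDr opprD expRD; ring.
have e1 y : expR (- (s * X y)) <= 1.
  by rewrite -expR0 ler_expR oppr_le0 mulr_ge0// ltW.
have mFy y : measurable_fun [set: R] (fun x : R => F (x, y)).
  rewrite /F /=; apply: measurable_funM; first exact: measurable_expN.
  by apply: measurable_funM => //; apply: (measurableT_comp mv); exact: measurable_funB.
have inner y : (\int[mu]_x (F (x, y))%:E = (g y * expR (- (s * X y)) * lap v s)%:E)%E.
  rewrite (@integral_shift _ (X y)); last exact/measurable_EFinP.
  under eq_integral do rewrite Fshift EFinM.
  rewrite integralZl// [RHS]EFinM; congr (_ * _)%E.
  by rewrite /lap /Rintegral fineK//; exact: integrable_fin_num.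
(* Since [exp (- s X y) <= 1], the inner integral of the absolute value is at most [K * g y]. *)
have iF : (mu \x m)%E.-integrable setT (EFin \o F).
  apply/integrable21ltyP => //.
  pose K := \int[mu]_x `|expR (- (s * x)) * v x|.
  have iv' := integrable_norm iv.
  have K0 : 0 <= K by apply: Rintegral_ge0.
  apply: (@le_lt_trans _ _ (\int[m]_y (K%:E * (g y)%:E))%E); last first.
    rewrite integralZl//.
    have : (\int[m]_y (g y)%:E)%E \is a fin_num by exact: integrable_fin_num.
    by move=> /fineK <-; rewrite -EFinM ltry.
  apply: ge0_le_integral => //.
  - by move=> y _; exact: integral_ge0.
  - apply: (@measurable_fun_fubini_tonelli_G _ _ _ _ R mu (abse \o (EFin \o F))) => //.
      exact: measurableT_comp.
    by move=> z; exact: abse_ge0.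
  - apply/measurable_EFinP; exact: measurable_funM.
  move=> y _.
  rewrite (@integral_shift _ (X y)); last first.
    by apply: measurableT_comp => //; exact/measurable_EFinP.
  under eq_integral => x _.
    rewrite /= Fshift normrM EFinM.
    over.
  rewrite integralZl// muleC.
  have -> : (\int[mu]_x `|expR (- (s * x)) * v x|%:E)%E = K%:E.
    by rewrite /K /Rintegral fineK//; exact: integrable_fin_num.
  rewrite lee_pmul//= lee_fin.
  by rewrite normrM !ger0_norm ?expR_ge0// ler_piMr.
have := Fubini iF.
rewrite -[LHS]/(\int[mu]_x \int[m]_y (F (x, y))%:E)%E -[RHS]/(\int[m]_y \int[mu]_x (F (x, y))%:E)%E.
have -> : (\int[mu]_x \int[m]_y (F (x, y))%:E = \int[mu]_x (expR (- (s * x)) * superpose v x)%:E)%E.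
  apply: eq_integral => x _.
  have ix : m.-integrable setT (fun y => (g y * v (x - X y))%:E).
    by apply: (integrable_bounded_mul ig (C := C)) => //; exact: measurable_shiftX.
  under eq_integral do rewrite /F /= EFinM.
  rewrite integralZl// [RHS]EFinM; congr (_ * _)%E.
  by rewrite /superpose /Rintegral fineK//; exact: integrable_fin_num.
under [in X in _ = X -> _]eq_integral do rewrite inner mulrC EFinM.
rewrite integralZl//; last first.
  apply: (integrable_bounded_mul ig (C := 1)).
    by apply: (measurableT_comp (measurable_expN s)).
  by move=> y; rewrite ger0_norm ?expR_ge0.
move=> H; rewrite {1}/lap /Rintegral H muleC fineM//.
apply: integrable_fin_num => //; apply: (integrable_bounded_mul ig (C := 1)).
  by apply: (measurableT_comp (measurable_expN s)).
by move=> y; rewrite ger0_norm ?expR_ge0.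
Qed.

End superposition.

(** * Gamma kernels *)

Section gamma_kernel.
Context {R : realType}.
Notation mu := (@lebesgue_measure R).
Implicit Types (l s p x y : R).

(** A single term of the exponential series is at most [expR x]. *)
Lemma exprn_expN_le (n : nat) x : 0 <= x -> x ^+ n.+1 * expR (- x) <= n.+1`!%:R.
Proof.
move=> x0; rewrite expRN ler_pdivrMr ?expR_gt0//.
have f0 : 0 < n.+1`!%:R :> R by rewrite ltr0n fact_gt0.
have := expR_ge1Dxn n x0.
move=> /(le_trans _) H; have : x ^+ n.+1 / n.+1`!%:R <= expR x by apply: H; rewrite lerDr.
by rewrite ler_pdivrMr// mulrC.
Qed.

Lemma powR_expN_bounded p l : 0 <= p -> 0 < l ->
  exists2 C : R, 0 < C & forall x : R, 0 <= x -> x `^ p * expR (- (l * x)) <= C.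
Proof.
move=> p0 l0.
have [n pn] : exists n : nat, p <= n.+1%:R.
  exists (Num.trunc p); exact/ltW/truncnS_gt.
(* The summand 1 serves for [x <= 1], the other one for [x > 1], where [x ^ p <= x ^ (n + 1)]. *)
exists (1 + n.+1`!%:R / l ^+ n.+1).
  by rewrite ltr_wpDr// divr_ge0// exprn_ge0// ltW.
move=> x x0.
have f0 : 0 <= n.+1`!%:R / l ^+ n.+1 by rewrite divr_ge0// exprn_ge0// ltW.
have [x1|x1] := leP x 1.
  rewrite (@le_trans _ _ 1)// ?lerDl// mulr_ile1 ?powR_ge0 ?expR_ge0//.
    by rewrite -(powRr0 x)//; have [->|xn0] := eqVneq x 0;
       [rewrite powRr0 /powR eqxx; case: eqP|rewrite ger_powR// lt0r xn0 x0].
  by rewrite -expR0 ler_expR oppr_le0 mulr_ge0// ltW.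
rewrite (@le_trans _ _ (n.+1`!%:R / l ^+ n.+1))// ?lerDr//.
rewrite ler_pdivlMr ?exprn_gt0//.
apply: le_trans (@exprn_expN_le n (l * x) _); last by rewrite mulr_ge0// ltW.
have xpn : x `^ p <= x ^+ n.+1 by rewrite -powR_mulrn// ler_powR// ltW.
by rewrite exprMn mulrC mulrA ler_wpM2r ?expR_ge0// ler_wpM2l// exprn_ge0// ltW.
Qed.

(** The Gamma density with shape [p] and rate [l], up to normalization. *)
Definition gamma_kernel p l y : R :=
  if 0 < y then y `^ (p - 1) * expR (- (l * y)) else 0.

Lemma gamma_kernel_ge0 p l y : 0 <= gamma_kernel p l y.
Proof. by rewrite /gamma_kernel; case: ifP => // _; rewrite mulr_ge0 ?powR_ge0 ?expR_ge0. Qed.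

Lemma gamma_kernel_le0 p l y : y <= 0 -> gamma_kernel p l y = 0.
Proof. by rewrite /gamma_kernel ltNge => ->. Qed.

Lemma measurable_gamma_kernel p l : measurable_fun [set: R] (gamma_kernel p l).
Proof.
apply: measurable_fun_ifT => //; first exact: measurable_fun_ltr.
apply: measurable_funM; last exact: measurable_expN.
exact: measurable_powR.
Qed.

Lemma gamma_kernel_expN p l s y :
  expR (- (s * y)) * gamma_kernel p l y = gamma_kernel p (l + s) y.
Proof.
rewrite /gamma_kernel; case: ifP => _; last by rewrite mulr0.
by rewrite mulrDl opprD expRD; ring.
Qed.

Lemma gamma_kernel_bounded p l : 1 <= p -> 0 < l ->
  exists2 C : R, 0 < C & forall y : R, `|gamma_kernel p l y| <= C.
Proof.
move=> p1 l0; have [||C C0 HC] := @powR_expN_bounded (p - 1) l; [lra|by []|].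
exists C => // y; rewrite ger0_norm ?gamma_kernel_ge0//.
by rewrite /gamma_kernel; case: ifP => y0; [exact/HC/ltW|exact: ltW].
Qed.

(** Half of the rate keeps the kernel bounded, the other half makes it integrable. *)
Lemma gamma_kernel_integrable p l : 1 <= p -> 0 < l ->
  mu.-integrable [set: R] (EFin \o gamma_kernel p l).
Proof.
move=> p1 l0; have l20 : 0 < l / 2 by lra.
have [C C0 HC] := gamma_kernel_bounded p1 l20.
have : mu.-integrable [set: R] (fun x => (expR (- ((l / 2) * x)) * gamma_kernel p (l / 2) x)%:E).
  apply: (laplace_line_integrable (C := C)) => //; first exact: measurable_gamma_kernel.
  by move=> x /ltW; exact: gamma_kernel_le0.
by apply: eq_integrable => // x _; rewrite gamma_kernel_expN -splitr.
Qed.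

(* Euler's Gamma(p). *)
Definition gamma_int p : R := \int[mu]_y gamma_kernel p 1 y.

Lemma gamma_int_gt0 p : 1 <= p -> 0 < gamma_int p.
Proof.
move=> p1; have ik := gamma_kernel_integrable p1 (@ltr01 R).
rewrite -lte_fin /gamma_int /Rintegral fineK; last exact: integrable_fin_num.
(* On [[1, 2]] the power is at least 1 and the exponential at least [exp (- 2)]. *)
apply: (@lt_le_trans _ _ (\int[mu]_x (expR (- 2) * \1_(`[1, 2]%classic) x)%:E)%E).
  under eq_integral do rewrite EFinM.
  rewrite ge0_integralZl ?lee_fin ?expR_ge0//; last first.
    by apply/measurable_EFinP; exact: measurable_indic.
  rewrite integral_indic// setIT.
  rewrite /= lebesgue_measure_itv/= lte_fin ltr1n.
  by rewrite -EFinD -EFinM lte_fin mulr_gt0 ?expR_gt0// subr_gt0 ltr1n.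
apply: ge0_le_integral => //.
- by apply/measurable_EFinP; apply: measurable_funM => //; exact: measurable_indic.
- by apply/measurable_EFinP; exact: measurable_gamma_kernel.
move=> x _; rewrite lee_fin indicE; have [|_] := boolP (x \in _); last by rewrite mulr0 gamma_kernel_ge0.
rewrite inE/= in_itv/= => /andP[x1 x2]; rewrite mulr1 /gamma_kernel ifT; last lra.
rewrite -[leLHS]mul1r ler_pM ?expR_ge0//; last by rewrite ler_expR mul1r lerN2.
by rewrite -[leLHS](powRr0 x) ler_powR//; lra.
Qed.

Lemma integral_gamma_kernel p l : 1 <= p -> 0 < l ->
  \int[mu]_y gamma_kernel p l y = gamma_int p * l `^ (- p).
Proof.
move=> p1 l0; have ik := gamma_kernel_integrable p1 l0.
have E x : gamma_kernel p 1 (l * x + 0) = l `^ (p - 1) * gamma_kernel p l x.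
  rewrite addr0 /gamma_kernel pmulr_rgt0//; case: ifP => x0; last by rewrite mulr0.
  by rewrite powRM ?ltW// mul1r mulrA.
rewrite /gamma_int {2}/Rintegral (ge0_integral_affine 0 l0); last 2 first.
  by apply/measurable_EFinP; exact: measurable_gamma_kernel.
  by move=> x; rewrite lee_fin gamma_kernel_ge0.
under [in RHS]eq_integral do rewrite E EFinM.
rewrite integralZl// !fineM//; last 2 first.
  exact: integrable_fin_num.
  by rewrite fin_numM//; exact: integrable_fin_num.
rewrite /= -/(Rintegral _ _ _) mulrA mulrAC mulr_powRB1 ?ltW//; last lra.
by rewrite powRN divff ?mul1r// gt_eqF// powR_gt0.
Qed.

Lemma lap_gamma_kernel p l s : 1 <= p -> 0 < l -> 0 < s ->
  lap (gamma_kernel p l) s = gamma_int p * (s + l) `^ (- p).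
Proof.
move=> p1 l0 s0; rewrite addrC -integral_gamma_kernel// ?addr_gt0//.
by rewrite /lap; apply: eq_Rintegral => x _; rewrite gamma_kernel_expN.
Qed.

Lemma gamma_kernel2E l y : gamma_kernel 2 l y = Num.max y 0 * expR (- (l * y)).
Proof.
rewrite /gamma_kernel; case: ltP => y0; last by rewrite mul0r.
by rewrite (_ : 2 - 1 = 1 :> R) ?powRr1 ?ltW//; lra.
Qed.

Lemma mulr_expN_le1 x : 0 <= x -> x * expR (- x) <= 1.
Proof. by move=> x0; have := @exprn_expN_le 0 x x0; rewrite expr1. Qed.

(** The derivative [(1 - l y) exp (- l y)] on the positive side lies between -1 and 1. Instead of
    the mean value theorem the proof uses [1 - exp (- z) <= z] and [z exp (- z) <= 1]. Shapes
    strictly between 1 and 2 give no Lipschitz bound at 0. *)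
Lemma gamma_kernel2_lip l x y : 0 < l ->
  `|gamma_kernel 2 l x - gamma_kernel 2 l y| <= `|x - y|.
Proof.
move=> l0; wlog xy : x y / x <= y.
  move=> H; have [/H//|/ltW/H] := leP x y.
  by rewrite distrC (distrC y).
have y0 : 0 <= y \/ y <= 0 by have [/ltW|] := ltP 0 y; [left|right].
have [x0|x0] := ltP x 0; last first.
  have {}y0 : 0 <= y by lra.
  rewrite !gamma_kernel2E !max_l//.
  have e0 := expR_gt0 (- (l * x)).
  have : expR (- (l * y)) <= expR (- (l * x)) by rewrite ler_expR lerN2 ler_pM2l.
  have eD : expR (- (l * y)) = expR (- (l * x)) * expR (- (l * (y - x))).
    by rewrite -expRD; congr expR; ring.
  have e1 : expR (- (l * y)) <= 1 by rewrite -expR0 ler_expR oppr_le0 mulr_ge0// ltW.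
  have e2 := expR_ge1Dx (- (l * (y - x))).
  have e3 : l * x * expR (- (l * x)) <= 1 by apply: mulr_expN_le1; rewrite mulr_ge0// ltW.
  move=> e4; rewrite distrC ler_norml.
  rewrite (distrC x) (ger0_norm (_ : 0 <= y - x)); last by rewrite subr_ge0.
  apply/andP; split.
    have : x * expR (- (l * x)) - x * expR (- (l * y)) <= y - x.
      rewrite eD.
      have : l * x * expR (- (l * x)) * (y - x) <= y - x.
        by rewrite -[leRHS]mul1r ler_wpM2r// subr_ge0.
      have : x * expR (- (l * x)) * (1 - expR (- (l * (y - x)))) <= x * expR (- (l * x)) * (l * (y - x)).
        by apply: ler_wpM2l; [rewrite mulr_ge0// ltW|lra].
      lra.
    have : x * expR (- (l * y)) <= y * expR (- (l * y)) by rewrite ler_wpM2r// expR_ge0.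
    lra.
  have : x * expR (- (l * y)) <= x * expR (- (l * x)) by rewrite ler_wpM2l.
  have : (y - x) * expR (- (l * y)) <= y - x.
    by rewrite -[leRHS]mulr1 ler_wpM2l// subr_ge0.
  lra.
rewrite (gamma_kernel_le0 _ _ (ltW x0)) sub0r normrN.
rewrite (ger0_norm (gamma_kernel_ge0 _ _ _)) distrC (ger0_norm (_ : 0 <= y - x)); last by rewrite subr_ge0.
have [yn|yp] := leP y 0; first by rewrite gamma_kernel_le0// subr_ge0.
rewrite gamma_kernel2E max_l ?ltW//.
have e1 : expR (- (l * y)) <= 1 by rewrite -expR0 ler_expR oppr_le0 mulr_ge0// ltW.
have : y * expR (- (l * y)) <= y by rewrite -[leRHS]mulr1 ler_wpM2l// ltW.
lra.
Qed.

Lemma gamma_kernel2_continuous l : 0 < l -> continuous (gamma_kernel 2 l).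
Proof.
move=> l0 x; apply/cvgrPdist_le => e e0; near=> y.
apply: le_trans (gamma_kernel2_lip x y l0) _.
by near: y; exact: cvgr_dist_le.
Unshelve. all: by end_near. Qed.

End gamma_kernel.

(** * Flat densities *)

Section flat_density.
Context {R : realType}.
Notation mu := (@lebesgue_measure R).
Implicit Types (F W : R -> R -> R) (f g : R -> R -> R) (a : R -> R).

(* The bounds for all [n] say that [f t] vanishes to infinite order at 0.  They
   survive division by [x], which is what makes [has_flat_density_primitive]
   possible. *)
Definition flat_density F f : Prop :=
  [/\ forall t x : R, x <= 0 -> f t x = 0,
      forall t : R, 0 < t -> continuous (f t),
      forall t x : R, 0 < t -> {for t, continuous (f ^~ x)},
      forall (t1 t2 : R) (n : nat), 0 < t1 -> exists2 C : R, 0 <= C &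
        forall t x : R, t1 <= t <= t2 -> 0 <= x -> `|f t x| <= C * x ^+ n &
      forall t s : R, 0 < t -> 0 < s -> lap (f t) s = F t s].

Definition has_flat_density F : Prop := exists f, flat_density F f.

Lemma flat_density_bounded F f t1 t2 : flat_density F f -> 0 < t1 ->
  exists2 C : R, 0 <= C & forall t x : R, t1 <= t <= t2 -> `|f t x| <= C.
Proof.
move=> [f0 _ _ fB _] t10; have [C C0 HC] := fB t1 t2 0%N t10.
exists C => // t x tt; have [x0|/ltW x0] := leP 0 x.
  by have := HC t x tt x0; rewrite expr0 mulr1.
by rewrite f0// normr0.
Qed.

Lemma flat_density_integrable F f t s : flat_density F f -> 0 < t -> 0 < s ->
  mu.-integrable [set: R] (fun x => (expR (- (s * x)) * f t x)%:E).
Proof.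
move=> ff t0 s0; have [C _ HC] := flat_density_bounded t ff t0.
have [f0 fc _ _ _] := ff.
apply: (laplace_line_integrable (C := C)) => //.
- by apply: continuous_measurable_fun; exact: fc.
- by move=> x /ltW; exact: f0.
- by move=> x; apply: HC; rewrite !lexx.
Qed.

Lemma flat_density_ext F W f : (forall t s : R, 0 < t -> 0 < s -> F t s = W t s) ->
  flat_density F f -> flat_density W f.
Proof.
move=> FW [f0 fc ft fB fl]; split => // t s t0 s0.
by rewrite fl// FW.
Qed.

Lemma has_flat_density_ext F W : (forall t s : R, 0 < t -> 0 < s -> F t s = W t s) ->
  has_flat_density F -> has_flat_density W.
Proof. by move=> FW [f ff]; exists f; exact: flat_density_ext ff. Qed.

Lemma flat_densityD F W f g : flat_density F f -> flat_density W g ->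
  flat_density (fun t s => F t s + W t s) (fun t x => f t x + g t x).
Proof.
move=> ff gg; have [f0 fc ft fB fl] := ff; have [g0' gc gt gB gl] := gg; split.
- by move=> t x x0; rewrite f0// g0'// addr0.
- by move=> t t0 x; apply: cvgD; [exact: fc|exact: gc].
- by move=> t x t0; apply: cvgD; [exact: ft|exact: gt].
- move=> t1 t2 n t10; have [C C0 HC] := fB t1 t2 n t10; have [D D0 HD] := gB t1 t2 n t10.
  exists (C + D) => [|t x tt x0]; first exact: addr_ge0.
  by rewrite mulrDl (le_trans (ler_normD _ _))// lerD ?HC ?HD.
- move=> t s t0 s0; rewrite -fl// -gl// /lap.
  under eq_Rintegral do rewrite mulrDr.
  by rewrite RintegralD//; apply: flat_density_integrable => //; eassumption.
Qed.

Lemma flat_densityM F f a : continuous a ->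
  (forall t1 t2, exists2 K : R, 0 <= K & forall t : R, t1 <= t <= t2 -> `|a t| <= K) ->
  flat_density F f ->
  flat_density (fun t s => a t * F t s) (fun t x => a t * f t x).
Proof.
move=> ca aB ff; have [f0 fc ft fB fl] := ff; split.
- by move=> t x x0; rewrite f0// mulr0.
- by move=> t t0 x; apply: cvgM; [exact: cvg_cst|exact: fc].
- by move=> t x t0; apply: cvgM; [exact: ca|exact: ft].
- move=> t1 t2 n t10; have [C C0 HC] := fB t1 t2 n t10; have [K K0 HK] := aB t1 t2.
  exists (K * C) => [|t x tt x0]; first exact: mulr_ge0.
  by rewrite normrM -mulrA ler_pM ?HK ?HC.
- move=> t s t0 s0; rewrite -fl// /lap.
  under eq_Rintegral do rewrite mulrCA.
  by rewrite RintegralZl//; apply: flat_density_integrable => //; eassumption.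
Qed.

Lemma flat_densityZ F f c : flat_density F f ->
  flat_density (fun t s => c * F t s) (fun t x => c * f t x).
Proof.
apply: (flat_densityM (a := fun=> c)) => [x|t1 t2]; first exact: cvg_cst.
by exists `|c|.
Qed.

Lemma has_flat_densityD F W : has_flat_density F -> has_flat_density W ->
  has_flat_density (fun t s => F t s + W t s).
Proof. by move=> [f ff] [g gg]; eexists; exact: flat_densityD ff gg. Qed.

Lemma has_flat_densityZ F c : has_flat_density F ->
  has_flat_density (fun t s => c * F t s).
Proof. by move=> [f ff]; eexists; exact: flat_densityZ ff. Qed.

(** The factor [t] arises when [exp (- t psi s)] is differentiated in [s]. *)
Lemma has_flat_density_time F : has_flat_density F ->
  has_flat_density (fun t s => t * F t s).
Proof.
move=> [f ff]; eexists; apply: flat_densityM ff; first by move=> x; exact: cvg_id.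
move=> t1 t2; exists (`|t1| + `|t2|) => [|t /andP[t1t tt2]]; first exact: addr_ge0.
have := ler_norm t2; have := ler_norm (- t1); rewrite normrN => ? ?.
have := normr_ge0 t1; have := normr_ge0 t2 => ? ?.
by rewrite ler_norml; apply/andP; split; lra.
Qed.

Lemma has_flat_density_gamma F p l : 1 <= p -> 0 < l -> has_flat_density F ->
  has_flat_density (fun t s => (s + l) `^ (- p) * F t s).
Proof.
move=> p1 l0 [f ff]; have [f0 fc ft fB fl] := ff.
(* [superpose] asks for nonnegative displacements; the kernel vanishes where the positive part
   differs from [y]. *)
pose g := gamma_kernel p l; pose X y : R := Num.max y 0.
have mg : measurable_fun [set: measurableTypeR R] g by exact: measurable_gamma_kernel.
have mX : measurable_fun [set: measurableTypeR R] X by exact: measurable_maxr.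
have g0 y : 0 <= g y by exact: gamma_kernel_ge0.
have X0 y : 0 <= X y by rewrite le_max lexx orbT.
have ig : mu.-integrable [set: R] (EFin \o g) by exact: gamma_kernel_integrable.
have mf t : 0 < t -> measurable_fun [set: R] (f t).
  by move=> t0; apply: continuous_measurable_fun; exact: fc.
have gi0 := gamma_int_gt0 p1.
suff : has_flat_density (fun t s => (gamma_int p * (s + l) `^ (- p)) * F t s).
  move=> /(has_flat_densityZ (gamma_int p)^-1); apply: has_flat_density_ext => t s _ _.
  by rewrite !mulrA mulVf ?mul1r// gt_eqF.
exists (fun t => superpose mu g X (f t)); split.
- by move=> t x x0; apply: superpose_le0 => // y; exact: f0.
- move=> t t0; have [C _ HC] := flat_density_bounded t ff t0.
  have HCt x : `|f t x| <= C by apply: HC; rewrite !lexx.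
  exact: (superpose_continuous mX g0 ig (fc t t0) HCt).
- move=> t x t0.
  have t20 : 0 < t / 2 by lra.
  have [C _ HC] := flat_density_bounded (2 * t) ff t20.
  apply: (weighted_continuous (Y := measurableTypeR R) (m := mu) g0 ig (w := fun l y => f l (x - X y)) (C := C) (a := t / 2) (b := 2 * t)).
  + move=> r; rewrite in_itv/= => /andP[r1 r2]; apply: measurable_shiftX => //.
    by apply: mf; lra.
  + move=> r y; rewrite in_itv/= => /andP[r1 r2]; apply: HC; apply/andP; split; exact: ltW.
  + move=> y r; rewrite in_itv/= => /andP[r1 r2]; apply: ft; lra.
  + rewrite in_itv/=; lra.
- move=> t1 t2 n t10; have [C C0 HC] := fB t1 t2 n t10.
  exists (C * \int[mu]_y g y) => [|t x tt x0].
    by rewrite mulr_ge0// Rintegral_ge0.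
  rewrite mulrAC; apply: (weighted_bound (Y := measurableTypeR R) (m := mu) g0 ig).
    by apply: measurable_shiftX => //; apply: mf; case/andP: tt; lra.
  (* Because [x - X y <= x], the bound [C * x ^+ n] is inherited by the translate. *)
  move=> y; have [xy|xy] := leP (x - X y) 0.
    by rewrite f0// normr0 mulr_ge0// exprn_ge0.
  rewrite (le_trans (HC t _ tt (ltW xy)))// ler_wpM2l// lerXn2r ?nnegrE//; first exact: ltW.
  by rewrite lerBlDr lerDl.
- move=> t s t0 s0; have [C _ HC] := flat_density_bounded t ff t0.
  have HCt x : `|f t x| <= C by apply: HC; rewrite !lexx.
  rewrite (lap_superpose mg mX g0 X0 ig s0 (fc t t0) (f0 t) HCt).
  rewrite fl// addrC -integral_gamma_kernel ?addr_gt0//; congr (_ * _).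
  apply: eq_Rintegral => y _; rewrite -gamma_kernel_expN mulrC /g.
  have [y0|y0] := leP y 0; first by rewrite gamma_kernel_le0// !mulr0.
  by rewrite /X max_l ?ltW.
Qed.

End flat_density.

(** * Differentiating Laplace transforms and recovering a function from the derivative *)

Section laplace_derivative.
Context {R : realType}.
Notation mu := (@lebesgue_measure R).

Lemma derive0_cvg0 (D : R -> R) : (forall s : R, 0 < s -> is_derive s 1 D 0) ->
  D s @[s --> +oo] --> 0 -> forall s : R, 0 < s -> D s = 0.
Proof.
move=> dD D0 s s0.
have Dcst s' : s < s' -> D s' = D s.
  move=> ss'.
  have dD' x : x \in `]s, s'[%R -> is_derive x 1 D ((fun=> 0) x).
    by rewrite in_itv/= => /andP[sx _]; apply: dD; exact: lt_trans sx.
  have cD : {within `[s, s'], continuous D}.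
    apply: derivable_within_continuous => x; rewrite in_itv/= => /andP[sx _].
    have := dD x (lt_le_trans s0 sx); by case.
  have [c _] := MVT ss' dD' cD.
  by rewrite mul0r => /eqP; rewrite subr_eq0 => /eqP.
apply/esym; apply: (cvg_unique _ D0); first exact: Rhausdorff.
apply: cvg_near_cst; near=> s'; apply: Dcst; near: s'.
apply: nbhs_pinfty_gt; exact: num_real.
Unshelve. all: by end_near. Qed.

Lemma lap_derive (v w : R -> R) (C C' s : R) : 0 < s ->
  measurable_fun [set: R] v -> measurable_fun [set: R] w ->
  (forall x : R, x < 0 -> v x = 0) -> (forall x, `|v x| <= C) ->
  (forall x, `|w x| <= C') -> (forall x, w x = x * v x) ->
  is_derive s 1 (lap v) (- lap w s).
Proof.
move=> s0 mv mw v0 vC wC wE.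
have w0 x : x < 0 -> w x = 0 by move=> x0; rewrite wE v0// mulr0.
have Is : `](s / 2), (2 * s)[%classic s by rewrite /= in_itv/=; lra.
have Ipos x : `](s / 2), (2 * s)[%classic x -> s / 2 < x /\ 0 < x.
  by rewrite /= in_itv/= => /andP[? _]; split => //; lra.
have dexp y (x : R) : is_derive x 1 (fun l => expR (- (l * y)) * v y) (- (expR (- (x * y)) * w y)).
  have d1 : is_derive x 1 (fun l : R => - (l * y)) (- y).
    have -> : (fun l : R => - (l * y)) = (- y) \*: (@id R).
      by apply/funext => l /=; rewrite scaleNr /GRing.scale/= mulrC.
    by apply: is_derive_eq; rewrite /GRing.scale/= mulr1.
  have d2 := @is_derive1_comp _ expR (fun l : R => - (l * y)) x _ _ (is_derive_expR _) d1.
  have -> : (fun l => expR (- (l * y)) * v y) = (v y) \*: (expR \o (fun l => - (l * y))).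
    by apply/funext => l /=; rewrite /GRing.scale/= mulrC.
  by apply: is_derive_eq; rewrite wE /GRing.scale/=; ring.
have intf x : `](s / 2), (2 * s)[%classic x ->
    mu.-integrable setT (EFin \o (fun y => expR (- (x * y)) * v y)).
  by move=> /Ipos[_ x0]; exact: (laplace_line_integrable (C := C)).
have derf (x y : R) : `](s / 2), (2 * s)[%classic x -> setT y ->
    derivable (fun l : R => expR (- (l * y)) * v y) x 1.
  by move=> _ _; have [] := dexp y x.
(* On the window []s / 2, 2 s[] the exponential is largest at the left end. *)
pose G y := `|expR (- ((s / 2) * y)) * w y|.
have iG : mu.-integrable setT (EFin \o G).
  apply: integrable_norm; apply: (laplace_line_integrable (C := C')) => //.
  by rewrite divr_gt0.
have d1E (x y : R) : partial1of2 (fun x y : R => expR (- (x * y)) * v y) x y = - (expR (- (x * y)) * w y).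
  by rewrite partial1of2E; have [_ ->] := dexp y x.
have Gub (x y : R) : `](s / 2), (2 * s)[%classic x -> setT y ->
    `|partial1of2 (fun x y : R => expR (- (x * y)) * v y) x y| <= G y.
  move=> /Ipos[sx x0] _; rewrite d1E normrN /G !normrM.
  have [y0|y0] := ltP y 0; first by rewrite w0// normr0 !mulr0.
  by rewrite ler_wpM2r// !ger0_norm ?expR_ge0// ler_expR lerN2 ler_wpM2r// ltW.
have G0 y : 0 <= G y by exact: normr_ge0.
have dF := derivable_under_integral measurableT Is intf derf G0 iG Gub.
have dE := differentiation_under_integral measurableT Is intf derf G0 iG Gub.
have -> : - lap w s = \int[mu]_y (partial1of2 (fun x y : R => expR (- (x * y)) * v y) ^~ y) s.
  rewrite /lap -[LHS]mulN1r -RintegralZl//; last exact: (laplace_line_integrable (C := C')).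
  by apply: eq_Rintegral => y _; rewrite d1E mulN1r.
by rewrite -dE derive1E; exact: DeriveDef.
Qed.

Lemma lap_cvg0 (v : R -> R) (C : R) : measurable_fun [set: R] v ->
  (forall x : R, x < 0 -> v x = 0) -> (forall x, `|v x| <= C) ->
  lap v s @[s --> +oo] --> 0.
Proof.
move=> mv v0 vC; apply/cvgrPdist_le => e e0; near=> s.
have s0 : 0 < s by near: s; apply: nbhs_pinfty_gt; exact: num_real.
rewrite sub0r normrN; apply: le_trans (lap_bound s0 mv v0 vC) _.
rewrite ler_pdivrMr// -ler_pdivrMl//; near: s; apply: nbhs_pinfty_ge; exact: num_real.
Unshelve. all: by end_near. Qed.

(* Multiplication by [x] corresponds to [- d/ds], so [f t x = w t x / x]; a
   Laplace transform is recovered from its derivative because it tends to 0 at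
   infinity. *)
Lemma has_flat_density_primitive (F W : R -> R -> R) : has_flat_density W ->
  (forall t s : R, 0 < t -> 0 < s -> is_derive s 1 (F t) (- W t s)) ->
  (forall t : R, 0 < t -> F t s @[s --> +oo] --> 0) ->
  has_flat_density F.
Proof.
move=> [w ww] dF F0; have [w0 wc wt wB wl] := ww.
pose f t x := w t x / x.
have f0 (t x : R) : x <= 0 -> f t x = 0 by move=> x0; rewrite /f w0// mul0r.
have fB (t1 t2 : R) (n : nat) : 0 < t1 -> exists2 C : R, 0 <= C &
    forall t x : R, t1 <= t <= t2 -> 0 <= x -> `|f t x| <= C * x ^+ n.
  (* The division uses up one power of [x], hence order [n.+1] for [w]. *)
  move=> t10; have [C C0 HC] := wB t1 t2 n.+1 t10; exists C => // t x tt.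
  rewrite le_eqVlt => /predU1P[<-|x0].
    by rewrite f0// normr0 mulr_ge0// exprn_ge0.
  have := HC t x tt (ltW x0).
  by rewrite /f normrM normfV (gtr0_norm x0) ler_pdivrMr// exprSr mulrA.
have fc t : 0 < t -> continuous (f t).
  move=> t0 x; have [x0|x0] := ltP 0 x.
    apply: cvgM; first exact: wc.
    by apply: cvgV; [rewrite gt_eqF|exact: cvg_id].
  (* The quotient rule fails at 0; there flatness of order 1 gives the continuity. *)
  have [C C0 HC] := fB t t 1%N t0.
  apply/cvgrPdist_le => e e0; near=> y.
  rewrite f0// sub0r normrN.
  have [y0|/ltW y0] := leP y 0; first by rewrite f0// normr0 ltW.
  rewrite (le_trans (HC t y _ y0))// ?lexx// expr1.
  have Cy : `|x - y| <= e / (C + 1) by near: y; apply: cvgr_dist_le => //; rewrite divr_gt0// ltr_wpDl.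
  move: Cy; rewrite ler_pdivlMr ?ltr_wpDl// distrC ger0_norm; last lra.
  have : C * y <= C * (y - x) by rewrite ler_wpM2l//; lra.
  nra.
have wM t x : w t x = x * f t x.
  rewrite /f; have [->|x0] := eqVneq x 0; first by rewrite mul0r w0.
  by rewrite mulrC divfK.
exists f; split => //.
- by move=> t x t0; apply: cvgM; [exact: wt|exact: cvg_cst].
move=> t s t0 s0.
have [C C0 HC] := flat_density_bounded t ww t0.
have [D D0 HD] := fB t t 0%N t0.
have wb x : `|w t x| <= C by apply: HC; rewrite !lexx.
have fb x : `|f t x| <= D.
  have [x0|x0] := leP x 0; first by rewrite f0// normr0.
  by have := HD t x; rewrite !lexx expr0 mulr1 => -> //; exact: ltW.
have mf := continuous_measurable_fun (fc t t0).
have mw := continuous_measurable_fun (wc t t0).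
have f0' (x : R) : x < 0 -> f t x = 0 by move=> /ltW; exact: f0.
apply/eqP; rewrite -subr_eq0; apply/eqP.
apply: (@derive0_cvg0 (fun s => lap (f t) s - F t s)) => //.
  move=> {}s {}s0.
  have d1 := lap_derive s0 mf mw f0' fb wb (wM t).
  have d2 := dF t s t0 s0.
  have := is_deriveB d1 d2; rewrite wl// subrr.
  exact.
rewrite -[X in _ --> X](subrr 0); apply: cvgB; [exact: lap_cvg0 mf f0' fb|exact: F0].
Unshelve. all: by end_near. Qed.

End laplace_derivative.

(** * The law of the process convolved with a Gamma kernel *)

Section smoothed_law.
Context {R : realType} d {T : measurableType d} (P : probability T R).
Variables (X : R -> T -> R) (psi : R -> R).
Hypothesis mX : forall t, measurable_fun [set: T] (X t).
Hypothesis X0 : forall t w, 0 <= X t w.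
Hypothesis lapX : forall t s : R, 0 < t -> 0 < s ->
  \int[P]_w expR (- (s * X t w)) = expR (- (t * psi s)).
Hypothesis contX : forall t e : R, 0 < t -> 0 < e ->
  P [set w | e <= `|X u w - X t w|] @[u --> t] --> 0%E.
Hypothesis psi0 : forall s : R, 0 < s -> 0 <= psi s.
Hypothesis psiB : forall (t : R) (n : nat), 0 < t -> exists2 C : R, 0 <= C &
  forall u : R, 0 < u -> u ^+ n * expR (- (t * psi u)) <= C.

(* The kernel [y exp (- l y)] is Lipschitz, hence continuity in [t] follows from
   continuity in probability.  Flatness at 0 is Chernoff's bound with exponent
   [u = 1 / x] and the fast decay of [exp (- t psi u)]. *)
Lemma has_flat_density_law l : 0 < l ->
  has_flat_density (fun t s => (s + l) `^ (- 2) * expR (- (t * psi s))).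
Proof.
move=> l0; have le12 : (1 : R) <= 2 by lra.
have gi0 := gamma_int_gt0 le12.
suff : has_flat_density (fun t s => (gamma_int 2 * (s + l) `^ (- 2)) * expR (- (t * psi s))).
  move=> /(has_flat_densityZ (gamma_int 2)^-1); apply: has_flat_density_ext => t s _ _.
  by rewrite !mulrA mulVf ?mul1r// gt_eqF.
pose k : R -> R := gamma_kernel 2 l.
have [K K0 kK] := gamma_kernel_bounded le12 l0.
have ck : continuous k by exact: gamma_kernel2_continuous.
have mk := continuous_measurable_fun ck.
have k0 (x : R) : x <= 0 -> k x = 0 by exact: gamma_kernel_le0.
have m1 : measurable_fun [set: T] (fun=> 1 : R) by [].
have i1 : P.-integrable [set: T] (EFin \o (fun=> 1 : R)).
  exact: finite_measure_integrable_cst.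
have int1 : \int[P]_w (1 : R) = 1.
  by rewrite Rintegral_cst// mul1r/= probability_setT.
have bint (h : T -> R) (C : R) : measurable_fun [set: T] h -> (forall w, `|h w| <= C) ->
    P.-integrable [set: T] (fun w => (h w)%:E).
  move=> mh hC; have := integrable_bounded_mul i1 mh hC.
  by apply: eq_integrable => // w _; rewrite mul1r.
have iexp t s : 0 < s -> P.-integrable [set: T] (fun w => (expR (- (s * X t w)))%:E).
  move=> s0; apply: (bint _ 1); first by apply: (measurableT_comp (measurable_expN s)).
  by move=> w; rewrite ger0_norm ?expR_ge0// -expR0 ler_expR oppr_le0 mulr_ge0// ltW.
have ik t x : P.-integrable [set: T] (fun w => (k (x - X t w))%:E).
  by apply: (bint _ K) => [|w]; [exact: measurable_shiftX|exact: kK].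
have fE t x : superpose P (fun=> 1) (X t) k x = \int[P]_w k (x - X t w).
  by apply: eq_Rintegral => w _; rewrite mul1r.
exists (fun t => superpose P (fun=> 1) (X t) k); split.
- by move=> t x x0; apply: superpose_le0.
- by move=> t t0; exact: (superpose_continuous (mX t) (fun=> ler01) i1 ck kK).
- move=> t x t0; apply/cvgrPdist_le => e e0.
  have e20 : 0 < e / 2 by lra.
  (* Displacements below [e / 2] cost at most [e / 2] by the Lipschitz bound. The others cost at
     most [2 * K] each, so their probability has to be below this threshold. *)
  have dl0 : 0 < e / 2 / (2 * K) by rewrite divr_gt0// mulr_gt0.
  have /fine_cvgP[_ /cvgrPdist_le/(_ _ dl0)] := contX t0 e20.
  apply: filterS => u /=; rewrite sub0r normrN => Pu.
  rewrite !fE -RintegralB; [|by []|exact: ik|exact: ik].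
  pose A := [set w | e / 2 <= `|X u w - X t w|].
  have mA : measurable A by apply: measurable_norm_ge; exact: measurable_funB.
  have iA : P.-integrable [set: T] (EFin \o (fun w => 2 * K * \1_A w)).
    rewrite /comp; under eq_fun do rewrite EFinM.
    by apply: integrableZl => //; exact: integrable_indic.
  have ie : P.-integrable [set: T] (EFin \o (fun=> e / 2)).
    exact: finite_measure_integrable_cst.
  have id' : P.-integrable [set: T] (EFin \o (fun w => k (x - X t w) - k (x - X u w))).
    by rewrite /comp; under eq_fun do rewrite EFinB; exact: integrableB.
  apply: le_trans (le_normr_Rintegral measurableT id') _.
  apply: (@le_trans _ _ (\int[P]_w (e / 2 + 2 * K * \1_A w))).
    apply: le_Rintegral => //.
    - exact: integrable_norm.
    - by rewrite /comp; under eq_fun do rewrite EFinD; exact: integrableD.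
    move=> w _; rewrite indicE; have [_|/negP nA] := boolP (w \in A).
      have := kK (x - X t w); have := kK (x - X u w).
      have := ler_normB (k (x - X t w)) (k (x - X u w)).
      rewrite -/k mulr1; lra.
    rewrite mulr0 addr0 (le_trans (gamma_kernel2_lip _ _ l0))//.
    rewrite opprB addrC addrA subrK ltW// ltNge; apply/negP => H.
    by apply: nA; rewrite inE.
  rewrite RintegralD// Rintegral_cst//= probability_setT mulr1.
  rewrite RintegralZl//; last exact: integrable_indic.
  have -> : \int[P]_w \1_A w = fine (P A).
    by rewrite /Rintegral integral_indic// setIT.
  have : 2 * K * fine (P A) <= e / 2.
    rewrite mulrC -ler_pdivlMr ?mulr_gt0//; apply: le_trans Pu; exact: ler_norm.
  lra.
- move=> t1 t2 n t10; have [C C0 HC] := psiB n t10.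
  exists (K * expR 1 * C) => [|t x /andP[t1t _]].
    by rewrite !mulr_ge0// ?expR_ge0// ltW.
  have t0 : 0 < t by exact: lt_le_trans t1t.
  rewrite le_eqVlt => /predU1P[<-|x0].
    rewrite superpose_le0// normr0 !mulr_ge0 ?exprn_ge0// ?expR_ge0// ltW//.
  have u0 : 0 < x^-1 by rewrite invr_gt0.
  rewrite fE; have ikt := ik t x.
  apply: le_trans (le_normr_Rintegral measurableT ikt) _.
  (* Where the kernel does not vanish, [X t w < x] and therefore [exp (1 - X t w / x) >= 1]. *)
  apply: (@le_trans _ _ (\int[P]_w (K * expR 1 * expR (- (x^-1 * X t w))))).
    apply: le_Rintegral => //.
    - exact: integrable_norm.
    - by rewrite /comp; under eq_fun do rewrite EFinM; apply: integrableZl => //; exact: iexp.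
    move=> w _; rewrite -mulrA -expRD.
    have [xX|xX] := leP (x - X t w) 0.
      by rewrite k0// normr0 mulr_ge0 ?expR_ge0// ltW.
    have e1 : 1 <= expR (1 - x^-1 * X t w).
      rewrite -[leLHS]expR0 ler_expR -(mulVf (lt0r_neq0 x0)) -mulrBr.
      by rewrite mulr_ge0// ltW.
    by apply: le_trans (kK _) _; rewrite -[leLHS]mulr1 ler_wpM2l// ltW.
  rewrite RintegralZl//; last exact: iexp.
  have Ke0 : 0 <= K * expR 1 by rewrite mulr_ge0 ?expR_ge0// ltW.
  rewrite lapX// -[leRHS]mulrA; apply: ler_wpM2l => //.
  (* Replacing [t] by [t1], which [psi >= 0] permits, makes the constant uniform in time. *)
  apply: (@le_trans _ _ (expR (- (t1 * psi x^-1)))).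
    by rewrite ler_expR lerN2 ler_wpM2r// psi0.
  by have := HC _ u0; rewrite exprVn mulrC ler_pdivrMr ?exprn_gt0.
- move=> t s t0 s0.
  rewrite (lap_superpose m1 (mX t) (fun=> ler01) (X0 t) i1 s0 ck k0 kK) lap_gamma_kernel// mulrC.
  congr (_ * _); rewrite -lapX//; apply: eq_Rintegral => w _; exact: mul1r.
Qed.

End smoothed_law.

(** * Powers times [exp (- t psi)] *)

Section power_symbols.
Context {R : realType}.
Variable E : R -> R -> R.
Hypothesis HE : forall l : R, 0 < l ->
  has_flat_density (fun t s => (s + l) `^ (- 2) * E t s).

(** The exponents carry a minus sign, so that positive [b] and [g] are shapes of Gamma kernels. *)
Definition power_symbol (l1 l2 b g t s : R) : R :=
  (s + l1) `^ (- b) * (s + l2) `^ (- g) * E t s.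

Lemma power_symbolC l1 l2 b g t s :
  power_symbol l1 l2 b g t s = power_symbol l2 l1 g b t s.
Proof. by rewrite /power_symbol (mulrC (_ `^ (- b))). Qed.

(* [s + l2 = (s + l1) + (l2 - l1)] moves exponents from one factor to the
   other, so that both can be made large enough for Gamma kernels. *)
Lemma power_symbol_shift l1 l2 b g t s : 0 < s -> 0 < l1 -> 0 < l2 ->
  power_symbol l1 l2 b g t s = power_symbol l1 l2 (b - 1) (g + 1) t s +
    (l2 - l1) * power_symbol l1 l2 b (g + 1) t s.
Proof.
move=> s0 l10 l20.
have sl1 : s + l1 != 0 by rewrite gt_eqF// addr_gt0.
have sl2 : s + l2 != 0 by rewrite gt_eqF// addr_gt0.
rewrite /power_symbol (_ : - (b - 1) = - b + 1); last by ring.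
rewrite (_ : (s + l2) `^ (- g) = (s + l2) `^ (- (g + 1)) * (s + l2)); last first.
  rewrite -[X in _ = _ * X]powRr1 ?addr_ge0 ?ltW// -powRD ?sl2 ?implybT//.
  by congr (_ `^ _); ring.
rewrite powRD ?sl1 ?implybT// powRr1 ?addr_ge0 ?ltW//.
by ring.
Qed.

Lemma has_flat_density_shift l1 l2 b g : 0 < l1 -> 0 < l2 ->
  has_flat_density (power_symbol l1 l2 (b - 1) (g + 1)) ->
  has_flat_density (power_symbol l1 l2 b (g + 1)) ->
  has_flat_density (power_symbol l1 l2 b g).
Proof.
move=> l10 l20 H1 /(has_flat_densityZ (l2 - l1)) H2.
apply: has_flat_density_ext (has_flat_densityD H1 H2) => t s _ s0.
by rewrite [RHS]power_symbol_shift.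
Qed.

(** One of the exponents is at least 3. Two units of it are spent on the smoothed law in [HE], and
    at least 1 remains for a Gamma kernel. *)
Lemma has_flat_density_power_pos l1 l2 b g : 0 < l1 -> 0 < l2 -> 1 <= b -> 1 <= g ->
  6 <= b + g -> has_flat_density (power_symbol l1 l2 b g).
Proof.
wlog b3 : l1 l2 b g / 3 <= b.
  move=> H l10 l20 b1 g1 bg; have [b3|b3] := leP 3 b; first exact: H.
  apply: (@has_flat_density_ext _ (power_symbol l2 l1 g b)).
    by move=> t s _ _; exact: power_symbolC.
  by apply: H => //; lra.
move=> l10 l20 b1 g1 bg.
have b21 : 1 <= b - 2 by lra.
have := has_flat_density_gamma b21 l10 (has_flat_density_gamma g1 l20 (HE l10)).
apply: has_flat_density_ext => t s t0 s0.
rewrite /power_symbol (_ : - b = - (b - 2) + (- 2)); last by ring.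
rewrite powRD; first by ring.
by rewrite (gt_eqF (addr_gt0 s0 l10)) implybT.
Qed.

(** Each shift raises [g] by one and costs [b] at most one; two of them bring [g] to at least 1. *)
Lemma has_flat_density_power_ge7 l1 l2 b g : 0 < l1 -> 0 < l2 -> 7 <= b -> -1 <= g ->
  has_flat_density (power_symbol l1 l2 b g).
Proof.
move=> l10 l20 b7 g1.
have ge6 b' g' : 6 <= b' -> 0 <= g' -> has_flat_density (power_symbol l1 l2 b' g').
  by move=> ? ?; apply: has_flat_density_shift => //; apply: has_flat_density_power_pos => //; lra.
by apply: has_flat_density_shift => //; apply: ge6; lra.
Qed.

(** If one exponent is below 1, the other exceeds 7. *)
Lemma has_flat_density_power_ge8 l1 l2 b g : 0 < l1 -> 0 < l2 -> -1 <= b -> -1 <= g ->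
  8 <= b + g -> has_flat_density (power_symbol l1 l2 b g).
Proof.
move=> l10 l20 b1 g1 bg.
have [gs|gs] := ltP g 1; first by apply: has_flat_density_power_ge7 => //; lra.
have [bs|bs] := ltP b 1; last by apply: has_flat_density_power_pos => //; lra.
apply: (@has_flat_density_ext _ (power_symbol l2 l1 g b)).
  by move=> t s _ _; exact: power_symbolC.
by apply: has_flat_density_power_ge7 => //; lra.
Qed.

End power_symbols.

(** * Decay and derivatives of the Laplace exponent *)

Section laplace_exponent.
Context {R : realType}.
Variables (a1 a2 l1 l2 c1 c2 : R).
Hypotheses (ha1 : 0 < a1 < 1) (ha2 : 0 < a2 < 1) (hl1 : 0 < l1) (hl2 : 0 < l2)
    (hc1 : 0 <= c1) (hc2 : 0 <= c2) (hc : c1 + c2 = 1).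

Definition mtss_exponent (s : R) : R :=
  c1 * ((s + l1) `^ a1 - l1 `^ a1) + c2 * ((s + l2) `^ a2 - l2 `^ a2).
Let psi := mtss_exponent.

Lemma powR_incr_ge0 (a l s : R) : 0 < a -> 0 < l -> 0 < s -> 0 <= (s + l) `^ a - l `^ a.
Proof.
move=> a0 l0 s0; rewrite subr_ge0 ge0_ler_powR ?nnegrE ?ltW// ?addr_gt0//.
by rewrite ltrDr.
Qed.

Lemma mtss_exponent_ge0 s : 0 < s -> 0 <= psi s.
Proof.
move=> s0; case/andP: ha1 => a10 _; case/andP: ha2 => a20 _.
by rewrite addr_ge0// mulr_ge0// powR_incr_ge0.
Qed.

(** With [y = (u + l)^a] one has [u^n <= y^(n / a)], and [y^(n / a) exp (- t c y)] is bounded. The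
    constant [exp (t c l^a)] makes up for the subtracted [l^a]. *)
Lemma exponent_decay (a l c : R) (n : nat) (t : R) : 0 < a -> 0 < l -> 0 < c -> 0 < t ->
  exists2 C : R, 0 <= C & forall u : R, 0 < u ->
    u ^+ n * expR (- (t * (c * ((u + l) `^ a - l `^ a)))) <= C.
Proof.
move=> a0 l0 c0 t0.
have tc0 : 0 < t * c by rewrite mulr_gt0.
have p0 : 0 <= n%:R / a by rewrite divr_ge0// ltW.
have [C C0 HC] := powR_expN_bounded p0 tc0.
exists (C * expR (t * c * l `^ a)) => [|u u0].
  by rewrite mulr_ge0 ?expR_ge0// ltW.
have ul0 : 0 < u + l by rewrite addr_gt0.
have := HC _ (powR_ge0 (u + l) a).
rewrite -powRrM (_ : a * (n%:R / a) = n%:R); last by field; rewrite gt_eqF.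
rewrite (powR_mulrn _ (ltW ul0)) => H.
rewrite (_ : - _ = - (t * c * (u + l) `^ a) + t * c * l `^ a); last by ring.
rewrite expRD mulrA ler_wpM2r ?expR_ge0//; apply: le_trans H.
rewrite ler_wpM2r ?expR_ge0// lerXn2r ?nnegrE ?(ltW u0) ?(ltW ul0)//.
by rewrite lerDl ltW.
Qed.

(** As [c1 + c2 = 1], one weight is positive; its term alone forces the decay, and the other term of
    [psi] is nonnegative. *)
Lemma mtss_exponent_decay (t : R) (n : nat) : 0 < t ->
  exists2 C : R, 0 <= C & forall u : R, 0 < u ->
    u ^+ n * expR (- (t * psi u)) <= C.
Proof.
move=> t0; case/andP: ha1 => a10 _; case/andP: ha2 => a20 _.
have [c10|c10] := ltP 0 c1.
  have [C C0 HC] := exponent_decay n a10 hl1 c10 t0; exists C => // u u0.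
  apply: le_trans (HC u u0); rewrite ler_wpM2l ?exprn_ge0 ?(ltW u0)// ler_expR lerN2.
  by rewrite ler_wpM2l ?(ltW t0)// lerDl mulr_ge0// powR_incr_ge0.
have c20 : 0 < c2 by move: hc c10; lra.
have [C C0 HC] := exponent_decay n a20 hl2 c20 t0; exists C => // u u0.
apply: le_trans (HC u u0); rewrite ler_wpM2l ?exprn_ge0 ?(ltW u0)// ler_expR lerN2.
by rewrite ler_wpM2l ?(ltW t0)// lerDr mulr_ge0// powR_incr_ge0.
Qed.

Lemma is_derive_powR_shift (l p s : R) : 0 < s + l ->
  is_derive s 1 (fun s : R => (s + l) `^ p) (p * (s + l) `^ (p - 1)).
Proof.
move=> sl0.
have d2 : is_derive s 1 (fun s : R => s + l) 1.
  by apply: is_derive_eq; rewrite addr0.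
have := @is_derive1_comp _ (fun x => x `^ p) (fun s => s + l) s _ _ (is_derive1_powR _ sl0) d2.
by rewrite mulr1.
Qed.

Lemma is_derive_mtss_exponent (s : R) : 0 < s ->
  is_derive s 1 psi (c1 * a1 * (s + l1) `^ (a1 - 1) + c2 * a2 * (s + l2) `^ (a2 - 1)).
Proof.
move=> s0.
have d1 := @is_derive_powR_shift l1 a1 s (addr_gt0 s0 hl1).
have d2 := @is_derive_powR_shift l2 a2 s (addr_gt0 s0 hl2).
have -> : psi = (c1 \*: ((fun s : R => (s + l1) `^ a1) - cst (l1 `^ a1))) +
                (c2 \*: ((fun s : R => (s + l2) `^ a2) - cst (l2 `^ a2))).
  by apply/funext.
by apply: is_derive_eq; rewrite /GRing.scale/=; ring.
Qed.

Let E t s := expR (- (t * psi s)).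

Lemma is_derive_power_symbol (b g t s : R) : 0 < s ->
  is_derive s 1 (power_symbol E l1 l2 b g t)
    (- (b * power_symbol E l1 l2 (b + 1) g t s + g * power_symbol E l1 l2 b (g + 1) t s +
        c1 * a1 * (t * power_symbol E l1 l2 (b + 1 - a1) g t s) +
        c2 * a2 * (t * power_symbol E l1 l2 b (g + 1 - a2) t s))).
Proof.
move=> s0.
have sl1 := addr_gt0 s0 hl1; have sl2 := addr_gt0 s0 hl2.
have d1 := @is_derive_powR_shift l1 (- b) s sl1.
have d2 := @is_derive_powR_shift l2 (- g) s sl2.
have d3 := is_derive_mtss_exponent s0.
have d4 : is_derive s 1 (fun s : R => - (t * psi s)) (- t * (c1 * a1 * (s + l1) `^ (a1 - 1) + c2 * a2 * (s + l2) `^ (a2 - 1))).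
  have -> : (fun s => - (t * psi s)) = (- t) \*: psi by apply/funext => x; rewrite /= scaleNr.
  exact: is_deriveZ.
have d5 := @is_derive1_comp _ expR (fun s => - (t * psi s)) s _ _ (is_derive_expR _) d4.
have -> : power_symbol E l1 l2 b g t =
   ((fun s : R => (s + l1) `^ (- b)) * (fun s : R => (s + l2) `^ (- g))) * (expR \o (fun s => - (t * psi s))).
  by apply/funext.
apply: is_derive_eq; rewrite /GRing.scale/= /power_symbol /E.
have P1 p q : (s + l1) `^ (p + q) = (s + l1) `^ p * (s + l1) `^ q.
  by apply: powRD; rewrite (gt_eqF sl1) implybT.
have P2 p q : (s + l2) `^ (p + q) = (s + l2) `^ p * (s + l2) `^ q.
  by apply: powRD; rewrite (gt_eqF sl2) implybT.
rewrite (_ : - (b + 1) = - b - 1); last by ring.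
rewrite (_ : - (g + 1) = - g - 1); last by ring.
rewrite (_ : - (b + 1 - a1) = - b + (a1 - 1)); last by ring.
rewrite (_ : - (g + 1 - a2) = - g + (a2 - 1)); last by ring.
rewrite !P1 !P2 fctE/=.
by ring.
Qed.

Lemma powR_shift_le (l p s : R) (n : nat) : 0 < l -> 1 <= s -> p <= n%:R ->
  (s + l) `^ p <= (s * (1 + l)) ^+ n.
Proof.
move=> l0 s1 pn; have sl1 : 1 <= s + l by lra.
apply: (@le_trans _ _ ((s + l) ^+ n)).
  by rewrite -powR_mulrn ?ler_powR//; lra.
rewrite lerXn2r ?nnegrE//; [lra|by rewrite mulr_ge0//; lra|].
by rewrite mulrDr mulr1 lerD2l ler_peMl// ltW.
Qed.

Lemma power_symbol_cvg0 (b g t : R) : 0 < t ->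
  power_symbol E l1 l2 b g t s @[s --> +oo] --> 0.
Proof.
move=> t0.
have [n1 bn] : exists n : nat, - b <= n%:R.
  by exists (Num.trunc (- b)).+1; exact/ltW/truncnS_gt.
have [n2 gn] : exists n : nat, - g <= n%:R.
  by exists (Num.trunc (- g)).+1; exact/ltW/truncnS_gt.
(* One power more than the prefactors need, which leaves [1 / s]. *)
have [C C0 HC] := mtss_exponent_decay (n1 + n2).+1 t0.
pose K := (1 + l1) ^+ n1 * (1 + l2) ^+ n2.
have K0 : 0 <= K by rewrite mulr_ge0// exprn_ge0// addr_ge0// ltW.
apply/cvgrPdist_le => e e0; near=> s.
have s1 : 1 <= s by near: s; apply: nbhs_pinfty_ge; exact: num_real.
have s0 : 0 < s by lra.
rewrite sub0r normrN /power_symbol ger0_norm; last first.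
  by rewrite !mulr_ge0 ?powR_ge0 ?expR_ge0.
apply: (@le_trans _ _ (K * (s ^+ (n1 + n2) * E t s))).
  rewrite mulrA ler_wpM2r ?expR_ge0//.
  apply: (@le_trans _ _ ((s * (1 + l1)) ^+ n1 * (s * (1 + l2)) ^+ n2)).
    by rewrite ler_pM ?powR_ge0// powR_shift_le.
  by rewrite !exprMn exprD /K le_eqVlt; apply/orP; left; apply/eqP; ring.
apply: (@le_trans _ _ (K * (C / s))).
  rewrite ler_wpM2l// ler_pdivlMr// mulrAC -exprSr.
  exact: HC.
rewrite mulrA ler_pdivrMr// -ler_pdivrMl//.
Unshelve. all: by end_near. Qed.

Hypothesis HE : forall l : R, 0 < l ->
  has_flat_density (fun t s => (s + l) `^ (- 2) * E t s).

(* [- d/ds] turns the symbol with exponents [b, g] into a combination of symbols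
   whose total exponent is larger by at least [min (1 - a1) (1 - a2)]; after
   finitely many steps they are products of Gamma kernels with the law. *)
Lemma has_flat_density_power (b g : R) : -1 <= b -> -1 <= g ->
  has_flat_density (power_symbol E l1 l2 b g).
Proof.
case/andP: ha1 => a10 a11; case/andP: ha2 => a20 a21.
pose dl := Num.min (1 - a1) (1 - a2).
have dl0 : 0 < dl by rewrite lt_min !subr_gt0 a11.
have dl1 : dl <= 1 - a1 by rewrite ge_min lexx.
have dl2 : dl <= 1 - a2 by rewrite ge_min lexx orbT.
suff H (k : nat) : forall b g, -1 <= b -> -1 <= g -> 8 <= b + g + k%:R * dl ->
    has_flat_density (power_symbol E l1 l2 b g).
  (* From [b + g >= -2] a total gain of 10 reaches the threshold 8. *)
  move=> b1 g1; apply: (H (Num.trunc (10 / dl)).+1) => //.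
  have : 10 / dl < (Num.trunc (10 / dl)).+1%:R by exact: truncnS_gt.
  rewrite ltr_pdivrMr//; lra.
elim: k => [|k IH] {}b {}g b1 g1.
  by rewrite mul0r addr0; exact: has_flat_density_power_ge8.
rewrite -[k.+1]addn1 natrD mulrDl mul1r => bg.
have H1 : has_flat_density (power_symbol E l1 l2 (b + 1) g) by apply: IH; lra.
have H2 : has_flat_density (power_symbol E l1 l2 b (g + 1)) by apply: IH; lra.
have H3 : has_flat_density (power_symbol E l1 l2 (b + 1 - a1) g) by apply: IH; lra.
have H4 : has_flat_density (power_symbol E l1 l2 b (g + 1 - a2)) by apply: IH; lra.
have H := has_flat_densityD (has_flat_densityD (has_flat_densityD
  (has_flat_densityZ b H1) (has_flat_densityZ g H2))
  (has_flat_densityZ (c1 * a1) (has_flat_density_time H3)))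
  (has_flat_densityZ (c2 * a2) (has_flat_density_time H4)).
apply: has_flat_density_primitive H _ _ => [t s t0 s0|t t0].
  exact: is_derive_power_symbol.
exact: power_symbol_cvg0.
Qed.

End laplace_exponent.

(** * Uniqueness of Laplace transforms *)

Section separating_polynomials.
Context {R : realType}.
Implicit Types (u r : R) (k n : nat).

Lemma bernoulli_le (y : R) n : 0 <= y <= 1 -> 1 - n%:R * y <= (1 - y) ^+ n.
Proof.
move=> /andP[y0 y1]; elim: n => [|n IH]; first by rewrite mul0r subr0 expr0.
rewrite exprS; apply: (@le_trans _ _ ((1 - y) * (1 - n%:R * y))).
  have : 0 <= n%:R * y * y by rewrite !mulr_ge0.
  rewrite -[n.+1]addn1 natrD; lra.
by rewrite ler_wpM2l// subr_ge0.
Qed.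

Lemma cvg_natr_exprn r : 0 <= r < 1 -> n%:R * r ^+ n @[n --> \oo] --> 0.
Proof.
(* The maximum keeps the base positive also for [r = 0], so that it can be written as [exp (- c)];
   then [n exp (- c n) <= 2 / (c^2 n)]. *)
move=> /andP[r0 r1]; pose q := Num.max r 2^-1.
have q0 : 0 < q by rewrite lt_max invr_gt0 ltr0n orbT.
have q1 : q < 1 by rewrite gt_max r1 invf_lt1 ?ltr1n.
have [c c0 qE] : exists2 c : R, 0 < c & q = expR (- c).
  by exists (- ln q); [rewrite oppr_gt0 ln_lt0// q0|rewrite opprK lnK].
have B n : (0 < n)%N -> n%:R * r ^+ n <= 2 / c ^+ 2 * n%:R^-1.
  move=> n0; have n0' : 0 < n%:R :> R by rewrite ltr0n.
  apply: (@le_trans _ _ (n%:R * q ^+ n)).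
    by rewrite ler_wpM2l// lerXn2r ?nnegrE ?(ltW q0)// le_max lexx.
  have := @exprn_expN_le R 1 (c * n%:R) (mulr_ge0 (ltW c0) (ltW n0')).
  rewrite qE -expRM_natr mulNr exprMn => H.
  rewrite ler_pdivlMr// ler_pdivlMr ?exprn_gt0//.
  by apply: le_trans H; rewrite le_eqVlt; apply/orP; left; apply/eqP; ring.
apply: (@squeeze_cvgr _ _ _ _ (fun=> 0) (fun n => 2 / c ^+ 2 * n%:R^-1)).
- near=> n; rewrite mulr_ge0 ?exprn_ge0// B//.
  by near: n; exists 1%N.
- exact: cvg_cst.
- rewrite -[X in _ --> X](mulr0 (2 / c ^+ 2)); apply: cvgM; first exact: cvg_cst.
  apply: (@gtr0_cvgV0 R nat \oo _ (fun n => n%:R) _).2; last exact: cvgr_idn.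
  by near=> n; rewrite ltr0n; near: n; exists 1%N.
Unshelve. all: by end_near. Qed.

(* The polynomials of the Brosowski-Deutsch proof of Stone-Weierstrass; the
   additional factor [n] in the exponent gives the limit 0 also when
   [k * u = 1], so that atoms at the threshold do no harm. *)
Definition step_poly k n : {poly R} := (1 - 'X^n) ^+ (n * k ^ n).

Lemma step_polyE k n u : (step_poly k n).[u] = (1 - u ^+ n) ^+ (n * k ^ n).
Proof. by rewrite /step_poly !hornerE. Qed.

Lemma step_poly_itv k n u : 0 <= u <= 1 -> 0 <= (step_poly k n).[u] <= 1.
Proof.
move=> /andP[u0 u1]; rewrite step_polyE.
have a : 0 <= 1 - u ^+ n by rewrite subr_ge0 exprn_ile1.
by rewrite exprn_ge0//= exprn_ile1// lerBlDr lerDl exprn_ge0.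
Qed.

(** Below the threshold Bernoulli's inequality bounds the value from below by [1 - n (k u)^n].
    Otherwise [1 - y <= exp (- y)] bounds it from above by [exp (- n (k u)^n) <= exp (- n)]. *)
Lemma step_poly_cvg k u : 0 <= u <= 1 ->
  (step_poly k n).[u] @[n --> \oo] --> (((k%:R * u < 1)%R)%:R : R).
Proof.
move=> u01; have /andP[u0 u1] := u01.
have un n : 0 <= u ^+ n <= 1 by rewrite exprn_ge0 //= exprn_ile1.
have NE n : (n * k ^ n)%:R * u ^+ n = n%:R * (k%:R * u) ^+ n.
  by rewrite natrM natrX exprMn mulrA.
have [ku|ku] := ltP (k%:R * u) 1.
  apply: (@squeeze_cvgr _ _ _ _ (fun n => 1 - n%:R * (k%:R * u) ^+ n) (fun=> 1)).
  - apply: nearW => n; rewrite -NE; have /andP[_ ->] := step_poly_itv k n u01.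
    by rewrite step_polyE bernoulli_le.
  - rewrite -[X in _ --> X](subr0 1); apply: cvgB; first exact: cvg_cst.
    by apply: cvg_natr_exprn; rewrite ku mulr_ge0.
  - exact: cvg_cst.
apply: (@squeeze_cvgr _ _ _ _ (fun=> 0) (fun n => expR (- n%:R))).
- apply: nearW => n; have /andP[-> _] /= := step_poly_itv k n u01.
  rewrite step_polyE; have /andP[un0 un1] := un n.
  apply: (@le_trans _ _ (expR (- u ^+ n) ^+ (n * k ^ n))).
    by rewrite lerXn2r ?nnegrE ?expR_ge0 ?subr_ge0//; exact: expR_ge1Dx.
  rewrite -expRM_natr ler_expR mulNr lerN2 mulrC NE -[leLHS]mulr1 ler_wpM2l//.
  exact: exprn_ege1.
- exact: cvg_cst.
- exact: cvgn_expR.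
Qed.

End separating_polynomials.

Section laplace_tail.
Context {R : realType} d {Y : measurableType d} (m : {measure set Y -> \bar R}).
Variables (h X : Y -> R).
Hypothesis mX : measurable_fun [set: Y] X.
Hypothesis X0 : forall y, 0 <= X y.
Hypothesis ih : m.-integrable [set: Y] (EFin \o h).

Let u s y : R := expR (- (s * X y)).

Lemma expN_itv s y : 0 < s -> 0 <= u s y <= 1.
Proof.
by move=> s0; rewrite expR_ge0/= -expR0 ler_expR oppr_le0 mulr_ge0// ltW.
Qed.

Lemma measurable_horner (p : {poly R}) : measurable_fun [set: R] (fun x => p.[x]).
Proof. by apply: continuous_measurable_fun; exact: continuous_horner. Qed.

Lemma measurable_u s : measurable_fun [set: Y] (u s).
Proof. by apply: (measurableT_comp (measurable_expN s)). Qed.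

Lemma integrable_poly (p : {poly R}) s : 0 < s ->
  m.-integrable [set: Y] (fun y => (h y * p.[u s y])%:E).
Proof.
move=> s0; apply: (integrable_bounded_mul ih (C := \sum_(i < size p) `|p`_i|)).
  by apply: (measurableT_comp (measurable_horner p)); exact: measurable_u.
move=> y; rewrite horner_coef (le_trans (ler_norm_sum _ _ _))//.
apply: ler_sum => i _; rewrite normrM ler_piMr//.
have /andP[? ?] := expN_itv y s0.
by rewrite normrX ger0_norm// exprn_ile1.
Qed.

Lemma step_poly_integral_cvg k s : 0 < s ->
  \int[m]_y (h y * (step_poly k n).[u s y]) @[n --> \oo] -->
  \int[m]_y (h y * ((k%:R * u s y < 1)%R)%:R).
Proof.
move=> s0.
have mh : measurable_fun [set: Y] h by apply/measurable_EFinP; case/integrableP : ih.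
have mlt : measurable_fun [set: Y] (fun y => ((k%:R * u s y < 1)%R)%:R : R).
  rewrite (_ : (fun y => _) = (fun y => if k%:R * u s y < 1 then 1 else 0)); last first.
    by apply/funext => y; case: ifP.
  apply: measurable_fun_ifT => //; apply: measurable_fun_ltr => //.
  by apply: measurable_funM => //; exact: measurable_u.
have [] := @dominated_convergence _ Y R m setT measurableT
  (fun n y => (h y * (step_poly k n).[u s y])%:E)
  (fun y => (h y * ((k%:R * u s y < 1)%R)%:R)%:E) (fun y => `|h y|%:E).
- by move=> n; case/integrableP: (integrable_poly (step_poly k n) s0).
- by apply/measurable_EFinP; exact: measurable_funM.
- apply: aeW => y _; apply: cvg_EFin; first exact: nearW.
  by apply: cvgM; [exact: cvg_cst|apply: step_poly_cvg; exact: expN_itv].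
- exact: integrable_norm.
- apply: aeW => y n _; rewrite /= lee_fin normrM ler_piMr//.
  by have /andP[? ?] := step_poly_itv k n (expN_itv y s0); rewrite ger0_norm.
move=> iF _ H; apply: fine_cvg; rewrite /= fineK; first exact: H.
exact: integrable_fin_num.
Qed.

End laplace_tail.

Section laplace_uniqueness.
Context {R : realType} d1 {Y1 : measurableType d1} (m1 : {measure set Y1 -> \bar R})
  d2 {Y2 : measurableType d2} (m2 : {measure set Y2 -> \bar R}).
Variables (h1 X1 : Y1 -> R) (h2 X2 : Y2 -> R).
Hypothesis mX1 : measurable_fun [set: Y1] X1.
Hypothesis mX2 : measurable_fun [set: Y2] X2.
Hypothesis X10 : forall y, 0 <= X1 y.
Hypothesis X20 : forall y, 0 <= X2 y.
Hypothesis ih1 : m1.-integrable [set: Y1] (EFin \o h1).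
Hypothesis ih2 : m2.-integrable [set: Y2] (EFin \o h2).
Hypothesis lapE : forall p : R, 0 <= p ->
  \int[m1]_y (h1 y * expR (- (p * X1 y))) = \int[m2]_y (h2 y * expR (- (p * X2 y))).

(** Powers of [exp (- s X)] are again exponentials of [X], so the hypothesis on transforms extends
    to polynomials by linearity. *)
Let poly_eq (p : {poly R}) s : 0 < s ->
  \int[m1]_y (h1 y * p.[expR (- (s * X1 y))]) = \int[m2]_y (h2 y * p.[expR (- (s * X2 y))]).
Proof.
move=> s0.
(* The additional monomial absorbs the ['X] of the induction step. *)
suff H (j : nat) : \int[m1]_y (h1 y * (p * 'X^j).[expR (- (s * X1 y))]) =
    \int[m2]_y (h2 y * (p * 'X^j).[expR (- (s * X2 y))]).
  by have := H 0%N; rewrite expr0 mulr1.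
elim/poly_ind: p j => [|p c IH] j.
  by under eq_Rintegral do rewrite mul0r horner0 mulr0; under [RHS]eq_Rintegral do rewrite mul0r horner0 mulr0; rewrite !Rintegral_cst// !mul0r.
have -> : (p * 'X + c%:P) * 'X^j = p * 'X^(j.+1) + c *: 'X^j.
  by rewrite mulrDl -mulrA -exprS mul_polyC.
under eq_Rintegral do rewrite hornerD mulrDr.
under [RHS]eq_Rintegral do rewrite hornerD mulrDr.
rewrite !RintegralD//; [|exact: integrable_poly..].
rewrite IH; congr (_ + _).
have E r x : r * (c *: 'X^j).[expR (- (s * x))] = c * (r * expR (- (s * j%:R * x))).
  rewrite hornerZ hornerXn -expRM_natr mulrCA; congr (_ * (_ * expR _)); ring.
under eq_Rintegral do rewrite E.
under [RHS]eq_Rintegral do rewrite E.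
have p0 : 0 <= s * j%:R by rewrite mulr_ge0// ltW.
have i1 : m1.-integrable setT (EFin \o (fun y => h1 y * expR (- (s * j%:R * X1 y)))).
  have := integrable_poly mX1 X10 ih1 'X^j s0.
  apply: eq_integrable => // y _; rewrite /= !hornerE -expRM_natr mulNr; congr (_ * expR _)%:E; ring.
have i2 : m2.-integrable setT (EFin \o (fun y => h2 y * expR (- (s * j%:R * X2 y)))).
  have := integrable_poly mX2 X20 ih2 'X^j s0.
  apply: eq_integrable => // y _; rewrite /= !hornerE -expRM_natr mulNr; congr (_ * expR _)%:E; ring.
by rewrite !RintegralZl// lapE.
Qed.

Lemma laplace_unique_tail (a : R) : 0 <= a ->
  \int[m1]_y (h1 y * ((a < X1 y)%R)%:R) = \int[m2]_y (h2 y * ((a < X2 y)%R)%:R).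
Proof.
move=> a0.
(* The threshold of the step polynomials is moved to [a]: for [a > 0], [2 exp (- s x) < 1] means
   [x > ln 2 / s]. For [a = 0] the factor 1 does it. *)
have [k [s [s0 ks]]] : exists (k : nat) (s : R), 0 < s /\
    forall x, (k%:R * expR (- (s * x)) < 1) = (a < x).
  move: a0; rewrite le_eqVlt => /predU1P[<-|a0].
    by exists 1%N, 1; split => // x; rewrite !mul1r expR_lt1 oppr_lt0.
  exists 2%N, (ln 2 / a); have l2 : 0 < ln (2 : R) by rewrite ln_gt0// ltr1n.
  split => [|x]; first by rewrite divr_gt0.
  rewrite -[X in X * _](@lnK _ 2%:R) ?posrE ?ltr0n// -expRD expR_lt1 subr_lt0.
  by rewrite mulrAC ltr_pdivlMr// ltr_pM2l.
have E1 := step_poly_integral_cvg mX1 X10 ih1 (k := k) s0.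
have E2 := step_poly_integral_cvg mX2 X20 ih2 (k := k) s0.
have -> : \int[m1]_y (h1 y * ((a < X1 y)%R)%:R) =
    \int[m1]_y (h1 y * ((k%:R * expR (- (s * X1 y)) < 1)%R)%:R).
  by apply: eq_Rintegral => y _; rewrite ks.
have -> : \int[m2]_y (h2 y * ((a < X2 y)%R)%:R) =
    \int[m2]_y (h2 y * ((k%:R * expR (- (s * X2 y)) < 1)%R)%:R).
  by apply: eq_Rintegral => y _; rewrite ks.
have eqn : (fun n => \int[m1]_y (h1 y * (step_poly k n).[expR (- (s * X1 y))])) =
    (fun n => \int[m2]_y (h2 y * (step_poly k n).[expR (- (s * X2 y))])).
  by apply/funext => n; exact: poly_eq.
rewrite eqn in E1; apply: (cvg_unique _ E1 E2); exact: Rhausdorff.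
Qed.

End laplace_uniqueness.

(** * Densities determined by their Laplace transforms *)

Section density_measure.
Context {R : realType}.
Notation mu := (@lebesgue_measure R).
Variable f : R -> R.
Hypothesis mf : measurable_fun [set: R] f.
Hypothesis f0 : forall x, 0 <= f x.

Definition density_measure (A : set (measurableTypeR R)) : \bar R :=
  (\int[mu]_(x in A) (f x)%:E)%E.

Let density0 : density_measure set0 = 0%E.
Proof. by rewrite /density_measure integral_set0. Qed.

Let density_ge0 A : (0 <= density_measure A)%E.
Proof. by apply: integral_ge0 => x _; rewrite lee_fin. Qed.

Let density_sigma_additive : semi_sigma_additive density_measure.
Proof.
move=> /= F mF tF mUF; rewrite /density_measure; apply: cvg_toP.
  apply: ereal_nondecreasing_is_cvgn => m n mn.
  apply: lee_sum_nneg_natr => // k _ _; apply: integral_ge0 => /= x Fkx.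
  by rewrite lee_fin.
rewrite ge0_integral_bigcup//=.
  by apply/measurable_funTS/measurable_EFinP.
by move=> x _; rewrite lee_fin.
Qed.

HB.instance Definition _ := isMeasure.Build _ _ _
  density_measure density0 density_ge0 density_sigma_additive.

End density_measure.

Section tails.
Context {R : realType}.
Notation mu := (@lebesgue_measure R).

(** Open right half-lines are closed under intersection, generate the Borel sets and exhaust the
    line. *)
Lemma eq_measure_tails (m1 m2 : {measure set (measurableTypeR R) -> \bar R}) :
  (forall a : R, m1 `]a, +oo[%classic = m2 `]a, +oo[%classic) ->
  (forall a : R, (m1 `]a, +oo[%classic < +oo)%E) ->
  forall A, measurable A -> m1 A = m2 A.
Proof.
move=> m12 m1oo A mA.
apply: (@measure_unique _ R (measurableTypeR R) (@RGenOInfty.G R) (fun n : nat => `](- (n%:R : R)), +oo[%classic)) => //.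
- exact: RGenOInfty.measurableE.
- move=> _ _ [x ->] [y ->]; exists (Num.max x y).
  by apply/seteqP; split => z /=; rewrite !in_itv/= !andbT gt_max => /andP.
- by move=> n; exists (- n%:R).
- apply/seteqP; split => // x _; exists (Num.trunc (- x)).+1 => //=.
  rewrite in_itv/= andbT ltrNl; exact: truncnS_gt.
- by move=> _ [x ->].
Qed.

Lemma integrable_itv_oc (h : R -> R) (a b : R) :
  (forall x : R, 0 < x -> {for x, continuous h}) -> 0 < a ->
  mu.-integrable `]a, b]%classic (EFin \o h).
Proof.
move=> ch a0; have : mu.-integrable `[a, b]%classic (EFin \o h).
  apply: continuous_compact_integrable; first exact: segment_compact.
  apply: continuous_in_subspaceT => y /[!inE] /=; rewrite in_itv/= => /andP[ay _].
  by apply: ch; exact: lt_le_trans ay.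
by apply: integrableS => //; exact: subset_itv_oc_cc.
Qed.

Lemma ge0_of_Rintegral_itv (h : R -> R) :
  (forall x : R, 0 < x -> {for x, continuous h}) ->
  (forall a b : R, 0 < a -> a < b -> 0 <= \int[mu]_(x in `]a, b]) h x) ->
  forall x : R, 0 < x -> 0 <= h x.
Proof.
move=> ch ih x x0; rewrite leNgt; apply/negP => hx.
have [e /= e0 He] : \forall y \near x, h y < h x / 2.
  by have /cvgr_lt := ch x x0; apply; lra.
(* The interval []a, x]] has to stay both positive and inside the neighbourhood where [h] is below
   [h x / 2]. *)
pose a := Num.max (x / 2) (x - e / 2).
have ax : a < x by rewrite gt_max; apply/andP; split; lra.
have a0 : 0 < a by rewrite lt_max; apply/orP; left; lra.
have ae : x - e < a by rewrite lt_max; apply/orP; right; lra.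
have := ih a x a0 ax; apply/negP; rewrite -ltNge.
apply: (@le_lt_trans _ _ (\int[mu]_(y in `]a, x]) (h x / 2))).
  apply: le_Rintegral => //; [exact: integrable_itv_oc|by apply: integrable_itv_oc => // y _; exact: cvg_cst|].
  move=> y; rewrite /= in_itv/= => /andP[ay yx]; apply/ltW/He => /=.
  by rewrite ger0_norm; lra.
rewrite Rintegral_cst//= lebesgue_measure_itv/= lte_fin ax -EFinD/=.
nra.
Qed.

(** Brings interval integrals into the form of [laplace_unique_tail], whose variable is nonnegative;
    beyond [a > 0] the positive part is [x] itself. *)
Lemma Rintegral_itv_tail (h : R -> R) (a b : R) : mu.-integrable [set: R] (EFin \o h) ->
  0 < a -> a < b ->
  \int[mu]_(x in `]a, b]) h x =
  \int[mu]_x (h x * ((a < Num.max x 0)%R)%:R) - \int[mu]_x (h x * ((b < Num.max x 0)%R)%:R).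
Proof.
move=> ih a0 ab; have b0 : 0 < b by lra.
have mX : measurable_fun [set: measurableTypeR R] (fun x : R => Num.max x 0).
  exact: measurable_maxr.
have it c : mu.-integrable [set: R] (EFin \o (fun x => h x * ((c < Num.max x 0)%R)%:R)).
  apply: (integrable_bounded_mul ih (measurable_gt_indicator c mX) (C := 1)) => y.
  by case: ltP => _; rewrite /= ?normr1 ?normr0.
rewrite -RintegralB//; [|exact: it..].
rewrite Rintegral_mkcond; apply: eq_Rintegral => x _.
rewrite patchE; case: ifPn; rewrite ?inE ?notin_setE /= in_itv/=.
  move=> /andP[ax xb]; rewrite lt_max ax.
  have -> : (b < Num.max x 0) = false by apply/negbTE; rewrite -leNgt ge_max xb ltW.
  by rewrite mulr1 mulr0 subr0.
rewrite !lt_max ![_ < 0]ltNge (ltW a0) (ltW b0) !orbF => /negP; rewrite negb_and -leNgt -ltNge.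
case/orP => H; first by rewrite !ltNge H (le_trans H (ltW ab))/= subrr.
by rewrite H (lt_trans ab H)/= subrr.
Qed.

Lemma lap_unique (v : R -> R) (C : R) : continuous v ->
  (forall x : R, x <= 0 -> v x = 0) -> (forall x, `|v x| <= C) ->
  (forall s : R, 0 < s -> lap v s = 0) -> forall x, v x = 0.
Proof.
move=> cv v0 vC lv.
have mv := continuous_measurable_fun cv.
have v0' x : x < 0 -> v x = 0 by move=> /ltW; exact: v0.
(* A bounded [v] need not be integrable. The weight repairs this and moves the parameter [p >= 0] to
   [1 + p > 0], where the transform is known. *)
pose h x := expR (- (1 * x)) * v x.
have ih : mu.-integrable [set: R] (EFin \o h) by exact: (laplace_line_integrable (C := C)).
have mX : measurable_fun [set: measurableTypeR R] (fun x : R => Num.max x 0).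
  exact: measurable_maxr.
have X0 (y : R) : 0 <= Num.max y 0 by rewrite le_max lexx orbT.
have i0 : mu.-integrable [set: R] (EFin \o (fun=> 0 : R)) by exact: integrable0.
have lapE p : 0 <= p -> \int[mu]_y (h y * expR (- (p * Num.max y 0))) =
    \int[mu]_y ((fun=> 0) y * expR (- (p * Num.max y 0))).
  move=> p0; under [RHS]eq_Rintegral do rewrite mul0r.
  rewrite Rintegral_cst// mul0r -[RHS](lv (1 + p)) ?ltr_wpDr//.
  apply: eq_Rintegral => y _; have [y0|y0] := leP y 0.
    by rewrite /h v0// !mulr0 mul0r.
  by rewrite /h mulrAC -expRD; congr (expR _ * _); ring.
have tail := laplace_unique_tail mX mX X0 X0 ih i0 lapE.
have hI a b : 0 < a -> a < b -> \int[mu]_(x in `]a, b]) h x = 0.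
  move=> a0 ab; rewrite Rintegral_itv_tail// !tail ?ltW//; last exact: lt_trans ab.
  by under eq_Rintegral do rewrite mul0r; under [X in _ - X]eq_Rintegral do rewrite mul0r; rewrite subrr.
have ch x : {for x, continuous h}.
  apply: cvgM; last exact: cv.
  apply: continuous_comp; last exact: continuous_expR.
  by apply: cvgN; apply: cvgM; [exact: cvg_cst|exact: cvg_id].
move=> x; have [x0|x0] := leP x 0; first exact: v0.
have h1 : 0 <= h x by apply: ge0_of_Rintegral_itv => // a b a0 ab; rewrite hI.
have h2 : 0 <= - h x.
  apply: (@ge0_of_Rintegral_itv (fun x => - h x)) => //.
    by move=> y _; apply: cvgN; exact: ch.
  move=> a b a0 ab; under eq_Rintegral do rewrite -mulN1r.
  rewrite RintegralZl ?hI ?mulr0//; exact: integrableS ih.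
have /eqP : h x = 0 by lra.
by rewrite /h mulf_eq0 expR_eq0/= => /eqP.
Qed.

End tails.

Section unweight.
Context {R : realType} d {Y : measurableType d} (m : {measure set Y -> \bar R}).

(** Monotone convergence in the extended reals; the limit is not assumed to be finite. *)
Lemma expN_weight_cvg (h X : Y -> R) :
  measurable_fun [set: Y] h -> measurable_fun [set: Y] X ->
  (forall y, 0 <= h y) -> (forall y, 0 <= X y) ->
  (\int[m]_y (h y * expR (- (n.+1%:R^-1 * X y)))%:E @[n --> \oo] -->
   \int[m]_y (h y)%:E)%E.
Proof.
move=> mh mX h0 X0.
have L y : (h y * expR (- (n.+1%:R^-1 * X y)))%:E @[n --> \oo] --> (h y)%:E.
  apply: cvg_EFin; first exact: nearW.
  rewrite -[X in _ --> X]mulr1; apply: cvgM; first exact: cvg_cst.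
  rewrite -[X in _ --> X]expR0; apply: continuous_cvg; first exact: continuous_expR.
  rewrite -[X in _ --> X]oppr0; apply: cvgN.
  rewrite -[X in _ --> X](mul0r (X y)); apply: cvgM; last exact: cvg_cst.
  exact: cvg_harmonic.
have -> : (\int[m]_y (h y)%:E = \int[m]_y limn (fun n => (h y * expR (- (n.+1%:R^-1 * X y)))%:E))%E.
  by apply: eq_integral => y _; apply/esym/cvg_lim => //; exact: L.
apply: cvg_monotone_convergence => //.
- move=> n; apply/measurable_EFinP; apply: measurable_funM => //.
  by apply: (measurableT_comp (measurable_expN _)).
- by move=> n y _; rewrite lee_fin mulr_ge0 ?expR_ge0.
- move=> y _ i j ij; rewrite lee_fin ler_wpM2l// ler_expR lerN2 ler_wpM2r//.
  by rewrite lef_pV2 ?posrE ?ltr0n// ler_nat.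
Qed.

End unweight.

Section law_density.
Context {R : realType} d {T : measurableType d} (P : probability T R).
Notation mu := (@lebesgue_measure R).
Variables (X : T -> R) (g : R -> R) (C : R).
Hypothesis mX : measurable_fun [set: T] X.
Hypothesis X0 : forall w, 0 <= X w.
Hypothesis cg : continuous g.
Hypothesis g0 : forall x : R, x <= 0 -> g x = 0.
Hypothesis gC : forall x, `|g x| <= C.
Hypothesis lapX : forall s : R, 0 < s -> \int[P]_w expR (- (s * X w)) = lap g s.

Let mg : measurable_fun [set: R] g.
Proof. exact: continuous_measurable_fun. Qed.

Let Z (x : R) : R := Num.max x 0.
Let mZ : measurable_fun [set: measurableTypeR R] Z.
Proof. exact: measurable_maxr. Qed.
Let Z0 x : 0 <= Z x. Proof. by rewrite le_max lexx orbT. Qed.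

Let i1 e : 0 < e -> P.-integrable [set: T] (EFin \o (fun w => expR (- (e * X w)))).
Proof.
move=> e0; have ic : P.-integrable [set: T] (EFin \o (fun=> 1 : R)).
  exact: finite_measure_integrable_cst.
have me : measurable_fun [set: T] (fun w => expR (- (e * X w))).
  by apply: (measurableT_comp (measurable_expN _)).
have := integrable_bounded_mul ic me (C := 1).
under eq_fun do rewrite mul1r; apply => w.
by rewrite ger0_norm ?expR_ge0// -expR0 ler_expR oppr_le0 mulr_ge0// ltW.
Qed.

Let i2 e : 0 < e -> mu.-integrable [set: R] (EFin \o (fun x => expR (- (e * x)) * g x)).
Proof.
move=> e0; apply: (laplace_line_integrable (C := C)) => //.
by move=> x /ltW; exact: g0.
Qed.

Let lapE e p : 0 < e -> 0 <= p ->
  \int[P]_w (expR (- (e * X w)) * expR (- (p * X w))) =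
  \int[mu]_x (expR (- (e * x)) * g x * expR (- (p * Z x))).
Proof.
move=> e0 p0; transitivity (lap g (e + p)).
  rewrite -lapX ?ltr_wpDr//; apply: eq_Rintegral => w _.
  by rewrite -expRD; congr expR; ring.
apply: eq_Rintegral => x _; rewrite /Z; have [x0|x0] := leP x 0.
  by rewrite g0// !mulr0 mul0r.
by rewrite mulrAC -expRD; congr (expR _ * _); ring.
Qed.

(** Neither integrability nor positivity of [g] is known yet, hence the comparison under a weight
    [exp (- e x)]. *)
Let tail e a : 0 < e -> 0 <= a ->
  \int[P]_w (expR (- (e * X w)) * ((a < X w)%R)%:R) =
  \int[mu]_x (expR (- (e * x)) * g x * ((a < Z x)%R)%:R).
Proof.
move=> e0 a0.
exact: (laplace_unique_tail mX mZ X0 Z0 (i1 e0) (i2 e0) (fun p => @lapE e p e0)).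
Qed.

Let b_gt (b : bool) : `|b%:R : R| <= 1.
Proof. by case: b; rewrite ?normr1 ?normr0. Qed.

(** By [tail], the weighted integral of [g] over []a, b]] is the weighted expectation of the event
    [a < X <= b]. *)
Lemma law_density_ge0 x : 0 <= g x.
Proof.
have [x0|x0] := leP x 0; first by rewrite g0.
pose h x := expR (- (1 * x)) * g x.
suff : 0 <= h x by rewrite /h pmulr_rge0// expR_gt0.
have ch y : {for y, continuous h}.
  apply: cvgM; last exact: cg.
  apply: continuous_comp; last exact: continuous_expR.
  by apply: cvgN; apply: cvgM; [exact: cvg_cst|exact: cvg_id].
apply: ge0_of_Rintegral_itv => // a b a0 ab.
have ih : mu.-integrable [set: R] (EFin \o h) by exact: i2.
rewrite (Rintegral_itv_tail ih)// -!tail ?(ltW a0)//; last by rewrite ltW// (lt_trans a0).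
rewrite subr_ge0; apply: le_Rintegral => //.
- by apply: (integrable_bounded_mul (i1 ltr01) (measurable_gt_indicator b mX) (C := 1)) => w; exact: b_gt.
- by apply: (integrable_bounded_mul (i1 ltr01) (measurable_gt_indicator a mX) (C := 1)) => w; exact: b_gt.
move=> w _; rewrite ler_wpM2l ?expR_ge0// ler_nat.
by have [bX|//] := ltP b (X w); rewrite (lt_trans ab bX).
Qed.

(** The weight can be removed by monotone convergence now that [g] is nonnegative; [phi] will be a
    tail indicator or 1. *)
Let unweight (phi : R -> R) : measurable_fun [set: R] phi -> (forall x, 0 <= phi x <= 1) ->
  (forall e, 0 < e -> \int[P]_w (expR (- (e * X w)) * phi (X w)) =
    \int[mu]_x (expR (- (e * x)) * g x * phi (Z x))) ->
  (\int[P]_w (phi (X w))%:E = \int[mu]_x (g x * phi (Z x))%:E)%E.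
Proof.
move=> mphi phi01 H.
have mpX : measurable_fun [set: T] (phi \o X) by exact: measurableT_comp.
have mpZ : measurable_fun [set: measurableTypeR R] (phi \o Z) by exact: measurableT_comp.
have pb y : `|phi y| <= 1 by have /andP[? ?] := phi01 y; rewrite ger0_norm.
have p0 y : 0 <= phi y by have /andP[] := phi01 y.
have c1 := expN_weight_cvg (m := P) mpX mX (fun w => p0 (X w)) X0.
have c2 := expN_weight_cvg (m := mu) (measurable_funM mg mpZ) mZ
  (fun x => mulr_ge0 (law_density_ge0 x) (p0 (Z x))) Z0.
apply: (cvg_unique _ c1); first exact: ereal_hausdorff.
suff -> : (fun n : nat => \int[P]_y ((phi \o X) y * expR (- (n.+1%:R^-1 * X y)))%:E)%E =
  (fun n : nat => \int[mu]_y ((g \* (phi \o Z)) y * expR (- (n.+1%:R^-1 * Z y)))%:E)%E.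
  exact: c2.
apply/funext => n; pose e : R := n.+1%:R^-1.
have e0 : 0 < e by rewrite invr_gt0 ltr0n.
have j1 := integrable_bounded_mul (i1 e0) mpX (fun w => pb (X w)).
have j2 := integrable_bounded_mul (i2 e0) mpZ (fun w => pb (Z w)).
transitivity (\int[P]_w (expR (- (e * X w)) * phi (X w)))%:E.
  rewrite /Rintegral fineK; last exact: integrable_fin_num.
  by apply: eq_integral => w _; rewrite mulrC.
rewrite H// /Rintegral fineK; last exact: integrable_fin_num.
apply: eq_integral => x _; congr EFin; rewrite /= /Z.
have [x0|x0] := leP x 0; first by rewrite g0// mulr0 !mul0r.
by rewrite -mulrA mulrC.
Qed.

Lemma law_densityE (A : set R) : measurable A ->
  P (X @^-1` A) = (\int[mu]_(x in A) (g x)%:E)%E.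
Proof.
move=> mA.
pose m1 : {measure set (measurableTypeR R) -> \bar R} := pushforward P (X : T -> measurableTypeR R).
pose m2 : {measure set (measurableTypeR R) -> \bar R} := density_measure g.
suff : m1 mX A = m2 mg law_density_ge0 A by [].
have tails a : m1 mX `]a, +oo[%classic = m2 mg law_density_ge0 `]a, +oo[%classic.
  have [a0|a0] := leP 0 a.
    have U := unweight (measurable_gt_indicator a (@measurable_id _ _ _)) (fun x => _) (fun e e0 => tail e0 a0).
    have {}U : (\int[P]_w ((a < X w)%R%:R)%:E = \int[mu]_x (g x * (a < Z x)%R%:R)%:E)%E.
      by apply: U => x; case: (a < x); rewrite ?ler01 ?lexx.
    rewrite /m1 /m2 /= /pushforward /density_measure.
    transitivity (\int[P]_w ((a < X w)%R%:R)%:E)%E.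
      have mXa : measurable (X @^-1` `]a, +oo[%classic).
        by rewrite -[X in measurable X]setTI; exact: mX.
      rewrite -[X in P X]setIT -integral_indic//; apply: eq_integral => w _.
      rewrite indicE; congr ((_ : bool)%:R%:E); apply/idP/idP.
        by rewrite inE/= in_itv/= andbT.
      by move=> aX; rewrite inE/= in_itv/= andbT.
    rewrite U [RHS]integral_mkcond; apply: eq_integral => x _.
    rewrite patchE; case: ifPn; rewrite ?inE ?notin_setE /= in_itv/= andbT.
      by move=> ax; rewrite /Z lt_max ax mulr1.
    by move=> /negP/negbTE ax; rewrite /Z lt_max ax ltNge a0 mulr0.
  (* For [a < 0] both sides are total masses, because [X >= 0] and [g] vanishes on the negative
     side. *)
  have U := unweight (phi := fun=> 1) (measurable_cst _) (fun x => _) _.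
  have {}U : (\int[P]_w (1 : R)%:E = \int[mu]_x (g x * 1)%:E)%E.
    apply: U => [|e e0]; first by rewrite ler01 lexx.
    have := lapE e0 (lexx 0).
    by under eq_Rintegral do rewrite mul0r oppr0 expR0; under [X in _ = X -> _]eq_Rintegral do rewrite mul0r oppr0 expR0.
  rewrite /m1 /m2 /= /pushforward /density_measure.
  rewrite (_ : X @^-1` _ = setT); last first.
    by apply/seteqP; split => // w _ /=; rewrite in_itv/= andbT (lt_le_trans a0).
  transitivity (\int[P]_w (1 : R)%:E)%E; first by rewrite integral_cst// mul1e.
  rewrite U [RHS]integral_mkcond; apply: eq_integral => x _.
  rewrite patchE mulr1; case: ifPn => //; rewrite notin_setE /= in_itv/= andbT.
  by move=> /negP; rewrite -leNgt => xa; rewrite g0// (le_trans xa)// ltW.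
apply: eq_measure_tails => // a.
by rewrite /m1 /= /pushforward (le_lt_trans (probability_le1 _ _)) ?ltry// -[X in measurable X]setTI; exact: mX.
Qed.

End law_density.

(** * Time derivative *)

Section time_derivative.
Context {R : realType}.
Notation mu := (@lebesgue_measure R).

Lemma derive0_cst_itv (D : R -> R) (b c t t' : R) :
  (forall u : R, b < u < c -> is_derive u 1 D 0) ->
  b < t < c -> b < t' < c -> D t = D t'.
Proof.
move=> dD; wlog tt' : t t' / t <= t'.
  by move=> H tbc t'bc; have [/H|/ltW/H] := leP t t'; [apply|move=> ->].
move: tt'; rewrite le_eqVlt => /predU1P[->//|tt'] /andP[bt _] /andP[_ tc].
have dD' x : x \in `]t, t'[%R -> is_derive x 1 D ((fun=> 0) x).
  by rewrite in_itv/= => /andP[? ?]; apply: dD; apply/andP; split; lra.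
have cD : {within `[t, t'], continuous D}.
  apply: derivable_within_continuous => x; rewrite in_itv/= => /andP[? ?].
  by have [] : is_derive x 1 D 0; first by apply: dD; apply/andP; split; lra.
have [z _] := MVT tt' dD' cD.
by rewrite mul0r => /eqP; rewrite subr_eq0 => /eqP ->.
Qed.

Lemma subr_swap (A A' B B' : R) : A - B = A' - B' -> A - A' - (B - B') = 0.
Proof. lra. Qed.

Variables (F W f w : R -> R -> R).
Hypothesis ff : flat_density F f.
Hypothesis ww : flat_density W w.
Hypothesis dF : forall t s : R, 0 < t -> 0 < s -> is_derive t 1 (F ^~ s) (W t s).

Variables (b c C : R).
Hypothesis b0 : 0 < b.
Hypothesis C0 : 0 <= C.
Hypothesis wC : forall t x : R, b <= t <= c -> `|w t x| <= C.

(** A primitive of [w] in time, to be compared with [f]: the two will differ by a function of [x]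
    alone. *)
Let U (t x : R) : R := \int[mu]_(u in `[b, t]) w u x.

Let w0 (t x : R) : x <= 0 -> w t x = 0. Proof. by have [w0 _ _ _ _] := ww; exact: w0. Qed.
Let wc (t : R) : 0 < t -> continuous (w t).
Proof. by have [_ wc _ _ _] := ww; exact: wc. Qed.
Let wt (t x : R) : 0 < t -> {for t, continuous (w ^~ x)}.
Proof. by have [_ _ wt _ _] := ww; exact: wt. Qed.

Let iw (x t : R) : mu.-integrable `[b, t]%classic (EFin \o (w ^~ x)).
Proof.
apply: continuous_compact_integrable; first exact: segment_compact.
apply: continuous_in_subspaceT => y /[!inE] /=; rewrite in_itv/= => /andP[by_ _].
by apply: wt; exact: lt_le_trans by_.
Qed.

Let icst (k t : R) : mu.-integrable `[b, t]%classic (EFin \o (fun=> k)).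
Proof.
apply: continuous_compact_integrable; first exact: segment_compact.
by apply: continuous_in_subspaceT => y _; exact: cvg_cst.
Qed.

Let dU (t x : R) : b < t < c -> is_derive t 1 (U ^~ x) (w t x).
Proof.
move=> /andP[bt tc].
have t0 : 0 < t by exact: lt_trans bt.
have [d1 d2] : derivable (U ^~ x) t 1 /\ (U ^~ x)^`()%classic t = w t x :=
  continuous_FTC1_closed tc (iw x c) bt (@wt t x t0).
apply: DeriveDef; first exact: d1.
by rewrite -derive1E; exact: d2.
Qed.

Let U0 (t x : R) : x <= 0 -> U t x = 0.
Proof.
move=> x0; rewrite /U (@eq_Rintegral _ _ _ _ _ (fun=> 0)).
  by rewrite Rintegral_cst// mul0r.
by move=> u _; exact: w0.
Qed.

Let UC (t x : R) : b < t < c -> `|U t x| <= C * (t - b).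
Proof.
move=> /andP[bt tc]; have iwt := iw x t.
apply: le_trans (le_normr_Rintegral _ iwt) _ => //.
apply: (@le_trans _ _ (\int[mu]_(u in `[b, t]) C)).
  apply: le_Rintegral => //; first exact: (integrable_norm iwt).
  move=> u; rewrite /= in_itv/= => /andP[bu ut]; apply: wC.
  by rewrite bu (le_trans ut)// ltW.
by rewrite Rintegral_cst//= lebesgue_measure_itv/= lte_fin bt -EFinD.
Qed.

Let Uc (t : R) : b < t < c -> continuous (U t).
Proof.
move=> /andP[bt tc] x.
have : {in `]x - 1, x + 1[%classic : set R, continuous (fun x => \int[mu]_(u in `[b, t]) w u x)}.
  apply: (@continuity_under_integral R _ _ mu (fun x u => w u x) `[b, t]%classic _ (x - 1) (x + 1) _ _ (fun=> C)).
  - by [].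
  - by move=> y _; exact: iw.
  - apply: aeW => u; rewrite /= in_itv/= => /andP[bu _] y _.
    by apply: wc; exact: lt_le_trans bu.
  - exact: icst.
  - move=> y _; apply: aeW => u; rewrite /= in_itv/= => /andP[bu ut]; apply: wC.
    by rewrite bu (le_trans ut)// ltW.
by apply; rewrite inE/= in_itv/=; lra.
Qed.

(** Dominates [w u] for all times [u] of the window; it is cut off at 0 because [exp (- s x)] is not
    integrable on the negative side. *)
Let v (x : R) : R := if 0 < x then C else 0.

Let dlapU (t s : R) : b < t < c -> 0 < s -> is_derive t 1 (fun t => lap (U t) s) (W t s).
Proof.
move=> tbc s0.
have It : `]b, c[%classic t by rewrite /= in_itv.
have UCt y : b < y < c -> forall x, `|U y x| <= C * (c - b).
  move=> ybc x; apply: le_trans (UC x ybc) _; rewrite ler_wpM2l//.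
  by case/andP: ybc => _ /ltW; lra.
have intf y : `]b, c[%classic y -> mu.-integrable setT (EFin \o (fun x => expR (- (s * x)) * U y x)).
  rewrite /= in_itv/= => ybc; apply: (laplace_line_integrable (C := C * (c - b))) => //.
  - by apply: continuous_measurable_fun; exact: Uc.
  - by move=> x /ltW; exact: U0.
  - exact: UCt.
have d1 y x : `]b, c[%classic y -> is_derive y 1 (fun y => expR (- (s * x)) * U y x) (expR (- (s * x)) * w y x).
  rewrite /= in_itv/= => ybc; have d1 := dU x ybc.
  have -> : (fun y => expR (- (s * x)) * U y x) = expR (- (s * x)) \*: (U ^~ x) by [].
  by apply: is_derive_eq.
have derf y x : `]b, c[%classic y -> setT x -> derivable (fun y : R => expR (- (s * x)) * U y x) y 1.
  by move=> /d1 H _; have [] := H x.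
have dE y x : `]b, c[%classic y -> partial1of2 (fun y x : R => expR (- (s * x)) * U y x) y x = expR (- (s * x)) * w y x.
  by move=> /d1 H; rewrite partial1of2E; have [_ ->] := H x.
pose G x := expR (- (s * x)) * v x.
have v0 x : 0 <= v x by rewrite /v; case: ifP.
have G0 x : 0 <= G x by rewrite mulr_ge0 ?expR_ge0.
have iG : mu.-integrable setT (EFin \o G).
  apply: (laplace_line_integrable (C := C)) => //.
  - by apply: measurable_fun_ifT => //; apply: measurable_fun_ltr.
  - by move=> x x0; rewrite /v ltNge (ltW x0).
  - by move=> x; rewrite ger0_norm// /v; case: ifP.
have Gub y x : `]b, c[%classic y -> setT x ->
    `|partial1of2 (fun y x : R => expR (- (s * x)) * U y x) y x| <= G x.
  move=> Iy _; rewrite dE// normrM ger0_norm ?expR_ge0// ler_wpM2l ?expR_ge0// /v.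
  case: ltP => x0; last by rewrite w0// normr0.
  by apply: wC; move: Iy; rewrite /= in_itv/= => /andP[/ltW -> /ltW ->].
have dF1 := derivable_under_integral measurableT It intf derf G0 iG Gub.
have dF2 := differentiation_under_integral measurableT It intf derf G0 iG Gub.
have -> : W t s = \int[mu]_x (partial1of2 (fun y x : R => expR (- (s * x)) * U y x) ^~ x) t.
  have [_ _ _ _ wl] := ww; rewrite -wl//; last by case/andP: tbc => /(lt_trans b0).
  by apply: eq_Rintegral => x _; rewrite dE.
by rewrite -dF2 derive1E; exact: DeriveDef.
Qed.

(* The Laplace transforms in [x] of both sides have the same derivative in
   [t]. *)
Let U_increment (t t' x : R) : b < t < c -> b < t' < c ->
  U t x - U t' x = f t x - f t' x.
Proof.
move=> tbc tbc'.
have t0 : 0 < t by case/andP: tbc => /(lt_trans b0).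
have t0' : 0 < t' by case/andP: tbc' => /(lt_trans b0).
have [f0 fc _ _ fl] := ff.
pose V x := (U t x - U t' x) - (f t x - f t' x).
have [D _ HD] := flat_density_bounded t ff t0.
have [D' _ HD'] := flat_density_bounded t' ff t0'.
suff : V x = 0 by move/eqP; rewrite subr_eq0 => /eqP.
apply: (@lap_unique _ V (C * (t - b) + C * (t' - b) + (D + D'))).
- by move=> y; apply: cvgB; apply: cvgB; [exact: Uc|exact: Uc|exact: fc|exact: fc].
- by move=> y y0; rewrite /V !U0// !f0// !subrr.
- move=> y; rewrite /V (le_trans (ler_normB _ _))// lerD// (le_trans (ler_normB _ _))// lerD//.
  + exact: UC.
  + exact: UC.
  + by apply: HD; rewrite !lexx.
  + by apply: HD'; rewrite !lexx.
move=> s s0.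
have iU u : b < u < c -> mu.-integrable setT (fun x => (expR (- (s * x)) * U u x)%:E).
  move=> ubc; apply: (laplace_line_integrable (C := C * (u - b))) => //.
  - by apply: continuous_measurable_fun; exact: Uc.
  - by move=> y /ltW; exact: U0.
  - by move=> y; exact: UC.
have iU1 := iU t tbc; have iU2 := iU t' tbc'.
have if1 := flat_density_integrable ff t0 s0.
have if2 := flat_density_integrable ff t0' s0.
have E : lap V s = (lap (U t) s - lap (U t') s) - (lap (f t) s - lap (f t') s).
  rewrite /lap -RintegralB// -[X in _ - X]RintegralB// -RintegralB//.
  - by apply: eq_Rintegral => y _; rewrite /V !mulrBr.
  - by rewrite /comp; under eq_fun do rewrite EFinB; exact: integrableB.
  - by rewrite /comp; under eq_fun do rewrite EFinB; exact: integrableB.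
rewrite E !fl//.
have : lap (U t) s - F t s = lap (U t') s - F t' s.
  apply: (@derive0_cst_itv (fun t => lap (U t) s - F t s) b c t t') => // u ubc.
  have u0 : 0 < u by case/andP: ubc => /(lt_trans b0).
  have := is_deriveB (dlapU ubc s0) (dF u0 s0).
  by rewrite subrr.
exact: subr_swap.
Qed.

(** Near [t] the function [f ^~ x] is [U ^~ x] plus the constant [f t x - U t x]. *)
Lemma flat_density_derive_itv (t x : R) : b < t < c ->
  is_derive t 1 (f ^~ x) (w t x).
Proof.
move=> tbc.
have d1 := dU x tbc.
have -> : w t x = w t x + 0 by rewrite addr0.
have d2 := is_deriveD d1 (is_derive_cst (f t x - U t x) t 1).
apply: near_eq_is_derive d2.
near=> u.
have ubc : b < u < c.
  near: u; exact: near_in_itvoo.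
rewrite -[RHS](subrK (f t x)) -(U_increment x ubc tbc) fctE /=.
by rewrite addrA addrAC.
Unshelve. all: by end_near. Qed.

End time_derivative.

Section time_derivative_global.
Context {R : realType}.

Lemma flat_density_derive (F W f w : R -> R -> R) :
  flat_density F f -> flat_density W w ->
  (forall t s : R, 0 < t -> 0 < s -> is_derive t 1 (F ^~ s) (W t s)) ->
  forall t x : R, 0 < t -> is_derive t 1 (f ^~ x) (w t x).
Proof.
move=> ff ww dF t x t0; have t20 : 0 < t / 2 by lra.
have [C C0 HC] := flat_density_bounded (2 * t) ww t20.
by apply: (flat_density_derive_itv ff ww dF t20 C0 HC); apply/andP; split; lra.
Qed.

End time_derivative_global.

(** * The mixture tempered stable subordinator *)

Section ae_law.
Context {R : realType} d {T : measurableType d} (P : probability T R).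

Lemma ae_eq_preimage (X Y : T -> R) (A : set R) : measurable_fun [set: T] X ->
  measurable_fun [set: T] Y -> {ae P, forall w, X w = Y w} -> measurable A ->
  P (X @^-1` A) = P (Y @^-1` A).
Proof.
move=> mX mY XY mA.
have mXA : measurable (X @^-1` A) by rewrite -[X in measurable X]setTI; exact: mX.
have mYA : measurable (Y @^-1` A) by rewrite -[X in measurable X]setTI; exact: mY.
rewrite -[X in P X]setIT -[X in _ = P X]setIT -!integral_indic//.
apply: ae_eq_integral => //.
- by apply/measurable_EFinP; exact: measurable_indic.
- by apply/measurable_EFinP; exact: measurable_indic.
apply: filterS XY => w XYw _; rewrite !indicE; congr ((_ : bool)%:R%:E).
by apply/idP/idP; rewrite !inE/= XYw.
Qed.

End ae_law.

Section half_line.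
Context {R : realType}.
Notation mu := (@lebesgue_measure R).

(** Links the transform of the statement, over [[0, +oo[], to [lap]. The value [f 0] is arbitrary,
    so the point 0 is discarded as a null set. *)
Lemma laplace_half_line (f g : R -> R) (s : R) :
  (forall x : R, x <= 0 -> g x = 0) -> (forall x : R, 0 < x -> f x = g x) ->
  mu.-integrable [set: R] (fun x => (expR (- (s * x)) * g x)%:E) ->
  laplace_integrable f s /\ laplace f s = lap g s.
Proof.
move=> g0 fg ig.
have io : mu.-integrable `]0, +oo[%classic (EFin \o (fun x => expR (- (s * x)) * f x)).
  have : mu.-integrable `]0, +oo[%classic (EFin \o (fun x => expR (- (s * x)) * g x)).
    exact: integrableS ig.
  apply: eq_integrable => // x; rewrite inE/= in_itv/= andbT => x0.
  by rewrite fg.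
have E : `[0%R, +oo[%classic `\` [set 0%R] = `]0%R, +oo[%classic :> set R.
  apply/seteqP; split => x /=; rewrite !in_itv/= !andbT lt_neqAle.
    by move=> [-> /eqP]; rewrite eq_sym andbT.
  by move=> /andP[/eqP x0 ->]; split => // /esym.
have mo : measurable_fun (`]0%R, +oo[%classic : set R) (fun x => expR (- (s * x)) * f x).
  by apply/measurable_EFinP; case/integrableP : io.
have ic : laplace_integrable f s.
  rewrite /laplace_integrable (negligible_integrable (N := ([set 0%R] : set (measurableTypeR R)))) ?E//.
  - by apply/measurable_EFinP/measurable_fun_itv_obnd_cbndP.
  - exact: lebesgue_measure_set1.
split => //; rewrite /laplace -Rintegral_itv_obnd_cbnd// /lap.
rewrite [RHS](_ : _ = \int[mu]_(x in `]0, +oo[) (expR (- (s * x)) * g x)); last first.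
  rewrite [RHS]Rintegral_mkcond; apply: eq_Rintegral => x _; rewrite patchE.
  case: ifPn => //; rewrite notin_setE /= in_itv/= andbT => /negP; rewrite -leNgt => x0.
  by rewrite g0// mulr0.
by apply: eq_Rintegral => x; rewrite inE/= in_itv/= andbT => x0; rewrite fg.
Qed.

(** Continuity upgrades the almost everywhere uniqueness of densities; nonnegativity of [k - h] is
    applied in both directions. *)
Lemma eq_of_density (f g : R -> R) :
  (forall x : R, 0 < x -> {for x, continuous f}) ->
  (forall x : R, 0 < x -> {for x, continuous g}) ->
  (forall a b : R, 0 < a -> a < b ->
    (\int[mu]_(x in `]a, b]) (f x)%:E = \int[mu]_(x in `]a, b]) (g x)%:E)%E) ->
  forall x : R, 0 < x -> f x = g x.
Proof.
move=> cf cg fg.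
have le (h k : R -> R) : (forall x : R, 0 < x -> {for x, continuous h}) ->
    (forall x : R, 0 < x -> {for x, continuous k}) ->
    (forall a b : R, 0 < a -> a < b ->
    (\int[mu]_(x in `]a, b]) (h x)%:E = \int[mu]_(x in `]a, b]) (k x)%:E)%E) ->
    forall x : R, 0 < x -> h x <= k x.
  move=> ch ck hk x x0; rewrite -subr_ge0.
  apply: (@ge0_of_Rintegral_itv R (fun x => k x - h x)) => //.
    by move=> y y0; apply: cvgB; [exact: ck|exact: ch].
  move=> a b a0 ab; rewrite RintegralB//; [|exact: integrable_itv_oc..].
  by rewrite /Rintegral hk// subrr.
move=> x x0; apply/eqP; rewrite eq_le; apply/andP; split; first exact: le.
by apply: le => // a b a0 ab; rewrite fg.
Qed.

End half_line.

(** * Weak convergence to the Dirac measure *)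

Section initial_condition.
Context {R : realType} d {T : measurableType d} (P : probability T R).
Notation mu := (@lebesgue_measure R).
Variables (S : R -> {RV P >-> R}) (G : R -> R -> R).
Hypothesis dG : density_of S G.
Hypothesis S0 : {ae P, forall w, S 0 w = 0}.
Hypothesis Sc : stochastically_continuous S.
Hypothesis Spos : forall t : R, 0 < t -> distribution P (S t) `]0, +oo[%classic = 1%E.

(** The integral is split at [dl / 2]: below it [phi] is close to [phi 0], and the mass above it
    tends to 0 by stochastic continuity at time 0. *)
Lemma density_initially_dirac : initially_dirac G.
Proof.
move=> phi cphi [M HM].
have M0 : 0 <= M by exact: le_trans (normr_ge0 _) (HM 0).
apply/cvgrPdist_le => e e0.
have e20 : 0 < e / 2 by lra.
have [dl /= dl0 Hdl] : \forall x \near (0 : R), `|phi 0 - phi x| <= e / 2.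
  by have /cvgrPdist_le/(_ _ e20) := cphi 0.
(* The 1 keeps the denominator positive when [M = 0]. *)
have eta0 : 0 < e / 2 / (2 * M + 1) by rewrite divr_gt0//; lra.
have dl20 : 0 < dl / 2 by lra.
have /fine_cvgP[_ /cvgrPdist_le/(_ _ eta0)] := Sc (lexx 0) dl20.
rewrite near_withinE => near0.
have nearp : \forall t \near 0^'+, `|0 - fine (P [set w | dl / 2 <= `|increment S 0 t w|])| <= e / 2 / (2 * M + 1).
  rewrite /at_right near_withinE; apply: filterS near0 => t H t0; apply: H; exact: ltW.
near=> t.
have t0 : 0 < t by near: t; exact: nbhs_right_gt.
have [cG G0 GE] := dG t0.
have PA : `|0 - fine (P [set w | dl / 2 <= `|increment S 0 t w|])| <= e / 2 / (2 * M + 1) by near: t.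
pose D : set (measurableTypeR R) := `]0, +oo[%classic.
have mD : measurable D by exact: measurable_itv.
have ID : (\int[mu]_(x in D) (G x t)%:E = 1)%E.
  by have := GE D mD; rewrite setIid Spos.
have mG : measurable_fun D (fun x => G x t).
  apply: (@subspace_continuous_measurable_fun R D) => //.
  by apply: continuous_in_subspaceT => x; rewrite inE => Dx; exact: cG.
have G0' x : D x -> 0 <= G x t by rewrite /D /= in_itv/= andbT; exact: G0.
have iG : mu.-integrable D (EFin \o (fun x => G x t)).
  apply/integrableP; split; first exact/measurable_EFinP.
  rewrite (_ : (\int[mu]_(x in D) _)%E = 1%E) ?ltry// -ID.
  by apply: eq_integral => x /[!inE] Dx; rewrite /= ger0_norm// G0'.
have mphi : measurable_fun D phi.
  by apply: measurable_funS (continuous_measurable_fun cphi).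
have iphiG : mu.-integrable D (EFin \o (fun x => phi x * G x t)).
  apply: (@le_integrable _ _ _ mu _ mD _ (fun x => M%:E * (G x t)%:E)%E); last exact: integrableZl.
    by apply/measurable_EFinP; exact: measurable_funM.
  move=> x Dx; rewrite /= lee_fin !normrM ler_wpM2r//.
  exact: le_trans (HM x) (ler_norm M).
have ID' : \int[mu]_(x in D) G x t = 1 by rewrite /Rintegral ID.
pose B : set (measurableTypeR R) := `]dl / 2, +oo[%classic.
have mB : measurable B by exact: measurable_itv.
have iGB : mu.-integrable D (EFin \o ((fun x => G x t) \_ B)).
  have : mu.-integrable (D `&` B) (EFin \o (fun x => G x t)).
    by apply: integrableS iG => //; exact: measurableI.
  by rewrite (integrable_restrict mu mB mD) restrict_EFin.
have PB : \int[mu]_(x in D) ((fun x => G x t) \_ B) x <= e / 2 / (2 * M + 1).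
  rewrite -Rintegral_mkcondr /Rintegral setIC -GE//.
  have mI : measurable_fun [set: T] (increment S 0 t) by exact: measurable_funB.
  have -> : distribution P (S t) B = P (increment S 0 t @^-1` B).
    apply: (@ae_eq_preimage _ _ _ P (S t) (increment S 0 t)) => //.
    apply: filterS S0 => w Sw.
    by rewrite /increment Sw subr0.
  have mIB : measurable (increment S 0 t @^-1` B).
    by rewrite -[X in measurable X]setTI; exact: mI.
  have mge : measurable [set w | dl / 2 <= `|increment S 0 t w|] by exact: measurable_norm_ge.
  move: PA; rewrite sub0r normrN; apply: le_trans.
  apply: le_trans (ler_norm _); apply: fine_le; [exact: fin_num_measure..|].
  apply: le_measure; rewrite ?inE// => w; rewrite /B /= in_itv/= andbT => /ltW H.
  exact: le_trans H (ler_norm _).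
have iphi0G : mu.-integrable D (EFin \o (fun x => phi 0 * G x t)).
  by rewrite /comp; under eq_fun do rewrite EFinM; exact: integrableZl.
have -> : phi 0 - \int[mu]_(x in D) (phi x * G x t) =
    \int[mu]_(x in D) (phi 0 * G x t - phi x * G x t).
  by rewrite RintegralB// RintegralZl// ID' mulr1.
have id' : mu.-integrable D (EFin \o (fun x => phi 0 * G x t - phi x * G x t)).
  by rewrite /comp; under eq_fun do rewrite EFinB; exact: integrableB.
apply: (@le_trans _ _ (\int[mu]_(x in D) `|phi 0 * G x t - phi x * G x t|)).
  exact: (le_normr_Rintegral mD id').
apply: (@le_trans _ _ (\int[mu]_(x in D) (e / 2 * G x t + 2 * M * ((fun x => G x t) \_ B) x))).
  have i1 : mu.-integrable D (EFin \o (fun x => e / 2 * G x t)).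
    by rewrite /comp; under eq_fun do rewrite EFinM; exact: integrableZl.
  have i2 : mu.-integrable D (EFin \o (fun x => 2 * M * ((fun x => G x t) \_ B) x)).
    by rewrite /comp; under eq_fun do rewrite EFinM; exact: integrableZl.
  apply: le_Rintegral => //.
  - exact: integrable_norm.
  - by rewrite /comp; under eq_fun do rewrite EFinD; exact: integrableD.
  move=> x Dx; have Gx := G0' x Dx.
  rewrite -mulrBl normrM (ger0_norm Gx) patchE; case: ifPn.
    move=> _; rewrite -mulrDl ler_wpM2r//.
    have := HM x; have := HM 0; have := ler_normB (phi 0) (phi x); lra.
  rewrite notin_setE /B /= in_itv/= andbT => /negP; rewrite -leNgt => xd.
  rewrite mulr0 addr0 ler_wpM2r//; apply: Hdl => /=.
  move: Dx; rewrite /D /= in_itv/= andbT => x0.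
  rewrite sub0r normrN gtr0_norm//; lra.
rewrite RintegralD//; last 2 first.
- by rewrite /comp; under eq_fun do rewrite EFinM; exact: integrableZl.
- by rewrite /comp; under eq_fun do rewrite EFinM; exact: integrableZl.
rewrite !RintegralZl// ID' mulr1.
have : 2 * M * \int[mu]_(x in D) ((fun x => G x t) \_ B) x <= e / 2.
  apply: le_trans (ler_wpM2l _ PB) _; first by rewrite mulr_ge0.
  rewrite mulrA ler_pdivrMr; last lra.
  by rewrite mulrC ler_wpM2l//; lra.
by move=> H; rewrite [leRHS]splitr lerD2l.
Unshelve. all: by end_near. Qed.

End initial_condition.

Section mtss_process.
Context {R : realType} d {T : measurableType d} (P : probability T R).
Notation mu := (@lebesgue_measure R).
Variables (a1 a2 l1 l2 c1 c2 : R) (S : R -> {RV P >-> R}).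
Hypotheses (ha1 : 0 < a1 < 1) (ha2 : 0 < a2 < 1) (hl1 : 0 < l1) (hl2 : 0 < l2)
    (hc1 : 0 <= c1) (hc2 : 0 <= c2) (hc : c1 + c2 = 1).
Hypothesis hS : mtss a1 l1 a2 l2 c1 c2 S.

Notation psi := (mtss_exponent a1 a2 l1 l2 c1 c2).
Let E (t s : R) := expR (- (t * psi s)).
(** [S t] is nonnegative only almost surely, whereas the Laplace arguments ask for [X >= 0]
    everywhere; the absolute value is a version with the same law. *)
Let X (t : R) (w : T) : R := `|S t w|.

Lemma mtss_start0 : {ae P, forall w, S 0 w = 0}.
Proof. by have [[]] := hS. Qed.

Let mX t : measurable_fun [set: T] (X t).
Proof. by apply: measurableT_comp => //; exact: measurable_funPT. Qed.

Let X0 t w : 0 <= X t w. Proof. exact: normr_ge0. Qed.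

Lemma mtss_ae_norm t : 0 <= t -> {ae P, forall w, S t w = `|S t w|}.
Proof.
move=> t0; have [_ Sinc _] := hS.
apply: filterS2 mtss_start0 Sinc => w S0 H.
by rewrite ger0_norm// -S0; exact: H.
Qed.

Let lapX (t s : R) : 0 < t -> 0 < s ->
  \int[P]_w expR (- (s * X t w)) = expR (- (t * psi s)).
Proof.
move=> t0 s0; have [_ _ /(_ t s (ltW t0) s0)] := hS.
rewrite unlock => H; rewrite /Rintegral.
rewrite -[RHS]/(fine (expR (- (t * psi s)))%:E) -H; congr fine.
apply: ae_eq_integral => //.
- by apply/measurable_EFinP; apply: (measurableT_comp (measurable_expN s)).
- apply/measurable_EFinP; apply: (measurableT_comp (measurable_expN s)).
  exact: measurable_funPT.
by apply: filterS (mtss_ae_norm (ltW t0)) => w Sw _; rewrite /X -Sw.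
Qed.

Let contX (t e : R) : 0 < t -> 0 < e ->
  P [set w | e <= `|X u w - X t w|] @[u --> t] --> 0%E.
Proof.
move=> t0 e0; have [[_ _ _ Sc] _ _] := hS.
have cS : P [set w | e <= `|increment S t u w|] @[u --> t] --> 0%E.
  (* Times near a positive [t] are nonnegative, so the one-sided neighbourhoods of the definition
     are full ones. *)
  have pos : \forall u \near t, 0 <= u.
    by near=> u; apply: ltW; near: u; exact: lt_nbhsr.
  move=> A /(Sc t e (ltW t0) e0) HA.
  by apply: filterS2 pos HA => u u0; exact.
apply: (squeeze_cvge _ (cvg_cst 0%E) cS).
apply: nearW => u; rewrite measure_ge0/=; apply: le_measure; rewrite ?inE.
- by apply: measurable_norm_ge; exact: measurable_funB.
- by apply: measurable_norm_ge; apply: measurable_funB; exact: measurable_funPT.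
by move=> w /= H; apply: le_trans H _; exact: ler_dist_dist.
Unshelve. all: by end_near. Qed.

Let HE (l : R) : 0 < l -> has_flat_density (fun t s => (s + l) `^ (- 2) * E t s).
Proof.
move=> l0; apply: (has_flat_density_law mX X0 lapX contX) => //.
- by move=> s s0; exact: mtss_exponent_ge0.
- by move=> t n t0; exact: mtss_exponent_decay.
Qed.

Lemma mtss_flat_density : exists2 f, flat_density E f &
  forall t : R, 0 < t -> (forall x, 0 <= f t x) /\
    forall A : set R, measurable A ->
      distribution P (S t) A = (\int[mu]_(x in A) (f t x)%:E)%E.
Proof.
have [f ff] := has_flat_density_power ha1 ha2 hl1 hl2 hc1 hc2 hc HE (lerN10 R) (lerN10 R).
exists f.
  apply: flat_density_ext ff => t s t0 s0.
  by rewrite /power_symbol oppr0 !powRr0 !mul1r.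
move=> t t0; have [f0 fc _ _ fl] := ff.
have [C _ HC] := flat_density_bounded t ff t0.
have fC x : `|f t x| <= C by apply: HC; rewrite !lexx.
have lX s : 0 < s -> \int[P]_w expR (- (s * X t w)) = lap (f t) s.
  by move=> s0; rewrite lapX// fl// /power_symbol oppr0 !powRr0 !mul1r.
split; first exact: (law_density_ge0 (mX t) (X0 t) (fc t t0) (f0 t) fC lX).
move=> A mA; rewrite -(law_densityE (mX t) (X0 t) (fc t t0) (f0 t) fC lX mA).
rewrite /distribution /pushforward; apply: ae_eq_preimage => //.
exact: mtss_ae_norm (ltW t0).
Qed.

(* [f1] and [f2] are the shifted derivatives of the density, whose value at 0+
   is 0. *)
Lemma mtss_fractional_densities : exists f1 f2,
  flat_density (fun t s => (l1 + s) `^ a1 * E t s) f1 /\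
  flat_density (fun t s => (l2 + s) `^ a2 * E t s) f2.
Proof.
have le1 : -1 <= 0 :> R by rewrite lerN10.
have la1 : -1 <= - a1 by case/andP: ha1; lra.
have la2 : -1 <= - a2 by case/andP: ha2; lra.
have [f1 ff1] := has_flat_density_power ha1 ha2 hl1 hl2 hc1 hc2 hc HE la1 le1.
have [f2 ff2] := has_flat_density_power ha1 ha2 hl1 hl2 hc1 hc2 hc HE le1 la2.
exists f1, f2; split.
- apply: flat_density_ext ff1 => t s t0 s0.
  by rewrite /power_symbol oppr0 powRr0 opprK mulr1 addrC.
- apply: flat_density_ext ff2 => t s t0 s0.
  by rewrite /power_symbol oppr0 powRr0 opprK mul1r addrC.
Qed.

(** In the Laplace variable the equation reads [d/dt exp (- t psi) = - psi exp (- t psi)]; expanding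
    [- psi] gives the four terms. *)
Lemma mtss_forward_equation f f1 f2 (t x : R) : flat_density E f ->
  flat_density (fun t s => (l1 + s) `^ a1 * E t s) f1 ->
  flat_density (fun t s => (l2 + s) `^ a2 * E t s) f2 -> 0 < t ->
  is_derive t 1 (f ^~ x) (- c1 * f1 t x - c2 * f2 t x +
    c1 * l1 `^ a1 * f t x + c2 * l2 `^ a2 * f t x).
Proof.
move=> ff ff1 ff2 t0.
have := flat_densityD (flat_densityD (flat_densityD (flat_densityZ (- c1) ff1)
  (flat_densityZ (- c2) ff2)) (flat_densityZ (c1 * l1 `^ a1) ff))
  (flat_densityZ (c2 * l2 `^ a2) ff).
move=> /(flat_density_derive ff) /(_ _ t x t0).
rewrite (mulNr c2); apply => {}t s {}t0 s0.
have d4 : is_derive t 1 (fun t : R => - (t * psi s)) (- psi s).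
  have -> : (fun t : R => - (t * psi s)) = (- psi s) \*: (@id R).
    by apply/funext => u /=; rewrite scaleNr /GRing.scale/= mulrC.
  by apply: is_derive_eq; rewrite /GRing.scale/= mulr1.
have := @is_derive1_comp _ expR (fun t : R => - (t * psi s)) t _ _ (is_derive_expR _) d4.
rewrite (_ : expR (- (t * psi s)) * - psi s = - c1 * ((l1 + s) `^ a1 * E t s) +
   - c2 * ((l2 + s) `^ a2 * E t s) + c1 * l1 `^ a1 * E t s + c2 * l2 `^ a2 * E t s)//.
by rewrite /E /mtss_exponent (addrC l1) (addrC l2); ring.
Qed.

Lemma mtss_start_dirac (A : set R) : measurable A ->
  distribution P (S 0) A = \d_(0 : R) A.
Proof.
move=> mA; rewrite /distribution /pushforward.
rewrite (@ae_eq_preimage _ _ _ P (S 0) (fun=> 0) A)//; last exact: mtss_start0.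
rewrite diracE; have [/set_mem A0|/negP A0] := boolP (0 \in A).
  by rewrite (_ : _ @^-1` _ = setT) ?probability_setT//; apply/seteqP; split.
rewrite (_ : _ @^-1` _ = set0) ?measure0//; apply/seteqP; split => // w /= HA.
by apply: A0; exact: mem_set.
Qed.

End mtss_process.

Theorem proposition3p4 (R : realType) (d : measure_display)
    (T : measurableType d) (P : probability T R)
    (a1 a2 l1 l2 c1 c2 : R) (S : R -> {RV P >-> R})
    (ha1 : 0 < a1 < 1) (ha2 : 0 < a2 < 1) (hl1 : 0 < l1) (hl2 : 0 < l2)
    (hc1 : 0 <= c1) (hc2 : 0 <= c2) (hc : c1 + c2 = 1)
    (hS : mtss a1 l1 a2 l2 c1 c2 S) :
  (exists G : R -> R -> R, density_of S G) /\
  forall G : R -> R -> R, density_of S G ->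
    [/\ exists D1 D2 : R -> R -> R,
          forall t : R, 0 < t ->
            [/\ shifted_RL l1 a1 (G ^~ t) (D1 ^~ t),
                shifted_RL l2 a2 (G ^~ t) (D2 ^~ t) &
                forall x : R, 0 < x ->
                  derivable (G x) t 1 /\
                  (G x)^`()%classic t = - c1 * D1 x t - c2 * D2 x t
                    + c1 * l1 `^ a1 * G x t + c2 * l2 `^ a2 * G x t],
        forall A : set R, measurable A ->
          distribution P (S 0) A = \d_(0 : R) A,
        initially_dirac G &
        forall t : R, 0 < t -> G x t @[x --> 0^'+] --> (0 : R)].
Proof.
have [f ff fP] := mtss_flat_density ha1 ha2 hl1 hl2 hc1 hc2 hc hS.
have [f1 [f2 [ff1 ff2]]] := mtss_fractional_densities ha1 ha2 hl1 hl2 hc1 hc2 hc hS.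
have [f0 fc _ _ _] := ff.
have fA (t : R) (A : set R) : 0 < t -> measurable A ->
    distribution P (S t) A =
    (\int[lebesgue_measure]_(x in A `&` `]0%R, +oo[) (f t x)%:E)%E.
  move=> t0 mA; have [_ ->//] := fP t t0.
  rewrite integral_mkcondr; apply: eq_integral => x _; rewrite patchE.
  case: ifPn => //; rewrite notin_setE /= in_itv/= andbT => /negP; rewrite -leNgt => x0.
  by rewrite f0.
split.
  exists (fun x t => f t x) => t t0; split.
  - by move=> x _; exact: fc.
  - by move=> x _; have [+ _] := fP t t0; apply.
  - by move=> A mA; exact: fA.
move=> G dG.
(* Every admissible [G] is the constructed [f] at positive points, so its properties can be read off
   from [f]. *)
have Gf (t x : R) : 0 < t -> 0 < x -> G x t = f t x.
  move=> t0 x0; have [cG _ GA] := dG t t0.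
  apply: (@eq_of_density R (G ^~ t) (f t)) => //.
  - by move=> y y0; apply: cG; rewrite in_itv/= y0.
  - by move=> y y0; exact: fc.
  move=> a b a0 ab.
  have E : `]a, b]%classic `&` `]0%R, +oo[%classic = `]a, b]%classic :> set R.
    apply/seteqP; split => y /=; first by case.
    by rewrite !in_itv/= => /andP[ay yb]; rewrite ay yb (lt_trans a0).
  by rewrite -{1}E -{2}E -GA// -fA.
have G0 (t : R) : 0 < t -> G x t @[x --> 0^'+] --> (0 : R).
  move=> t0.
  have : f t x @[x --> 0^'+] --> (0 : R).
    by rewrite -[X in _ --> X](f0 t 0 (lexx 0)); apply: cvg_at_right_filter; exact: fc.
  apply: cvg_trans; apply: near_eq_cvg; near=> x; apply/esym/Gf => //.
(* With boundary value 0 the term containing [(l + s)^(a - 1)] drops out. *)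
have shifted a l g : flat_density (fun t s => (l + s) `^ a *
      expR (- (t * mtss_exponent a1 a2 l1 l2 c1 c2 s))) g ->
    forall t, 0 < t -> shifted_RL l a (G ^~ t) (fun x => g t x).
  move=> gg t t0; have [g0 gc _ _ gl] := gg; split; first by move=> x _; exact: gc.
  exists 0; first exact: G0.
  move=> s s0.
  have [i1 e1] := laplace_half_line (f0 t) (fun x => @Gf t x t0) (flat_density_integrable ff t0 s0).
  have [i2 e2] := @laplace_half_line R (g t) (g t) s (g0 t) (fun x _ => erefl) (flat_density_integrable gg t0 s0).
  have [_ _ _ _ fl] := ff.
  by split => //; rewrite e1 e2 gl// fl// mulr0 subr0.
split => //.
- exists (fun x t => f1 t x), (fun x t => f2 t x) => t t0; split.
  + exact: shifted ff1 t t0.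
  + exact: shifted ff2 t t0.
  move=> x x0.
  have dfG : is_derive t 1 (G x) (- c1 * f1 t x - c2 * f2 t x +
      c1 * l1 `^ a1 * G x t + c2 * l2 `^ a2 * G x t).
    rewrite Gf//; have := mtss_forward_equation x ff ff1 ff2 t0.
    apply: near_eq_is_derive; near=> u; apply/esym/Gf => //.
    by near: u; exact: lt_nbhsr.
  by rewrite derive1E; have [? ->] := dfG.
- by move=> A mA; exact: (mtss_start_dirac hS).
- apply: (density_initially_dirac dG).
  + exact: (mtss_start0 hS).
  + by have [[]] := hS.
  move=> t t0.
  (* There is no atom at 0: the density [f] carries the whole mass and lives on the positive
     half-line. *)
  have E : distribution P (S t) `]0%R, +oo[%classic = distribution P (S t) [set: R].
    by rewrite !fA// setTI setIid.
  by rewrite E; exact: probability_setT.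
Unshelve. all: by end_near. Qed.
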